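(* Consider $$x^{\Delta}(t)=a(t)x(t)+b(t)x(\delta_{-}(h,t))\delta_{-}^{\Delta}(h,t),\qquad t\in[t_0,\infty)_{\mathbb{T}}.\tag{E}$$ Put $Q(t):=a(t)+b(\delta_{+}(h,t))$ and $\beta(t):=t-\delta_{-}(h,t)$. Suppose there exists a positive constant $D$ such that $$\beta(t)<D\le\frac{Q(t)}{b(\delta_{+}(h,t))^{2}}$$ for all $t\in[t_0,\infty)_{\mathbb{T}}$. Suppose also that $\beta(t)$ is bounded above by a constant $\beta_0$ with $0<\beta_0<D$. Then the zero solution of (E) is unstable, provided that $$\lim_{t\to\infty}\int_{t_0}^{t}b(\delta_{+}(h,s))^{2}\,\Delta s=\infty .$$
   Context: A time scale $\mathbb{T}$ is a nonempty closed subset of $\mathbb{R}$; $\sigma(t)=\inf\{s\in\mathbb{T}:s>t\}$ is the forward jump operator, $\mu(t)=\sigma(t)-t$, $f^{\Delta}$ is the delta derivative, $\int\cdot\,\Delta s$ the delta integral, and $[a,b]_{\mathbb{T}}=[a,b]\cap\mathbb{T}$ (similarly for other intervals). ''rd-continuous'' means continuous at right-dense points with finite left-sided limits at left-dense points. Shift operators. Let $\mathbb{T}^{*}\subseteq\mathbb{T}$ be nonempty and $t_0\in\mathbb{T}^{*}$. Backward and forward shift operators $\delta_{-},\delta_{+}$ associated with the initial point $t_0$ are operators $\delta_{\pm}$ of $(s,t)\in[t_0,\infty)_{\mathbb{T}}\times\mathbb{T}^{*}$, with domains $\mathcal{D}_{\pm}=\{(s,t)\in[t_0,\infty)_{\mathbb{T}}\times\mathbb{T}^{*}:\delta_{\pm}(s,t)\in\mathbb{T}^{*}\}$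 (pairs where the operator is defined with value in $\mathbb{T}^*$), satisfying: P.1: $\delta_{\pm}$ are strictly increasing in their second arguments, i.e. if $(T_0,t),(T_0,u)\in\mathcal{D}_{\pm}$, then $T_0\le t<u$ implies $\delta_{\pm}(T_0,t)<\delta_{\pm}(T_0,u)$. P.2: if $(T_1,u),(T_2,u)\in\mathcal{D}_{-}$ with $T_1<T_2$ then $\delta_{-}(T_1,u)>\delta_{-}(T_2,u)$; if $(T_1,u),(T_2,u)\in\mathcal{D}_{+}$ with $T_1<T_2$ then $\delta_{+}(T_1,u)<\delta_{+}(T_2,u)$. P.3: if $t\in[t_0,\infty)_{\mathbb{T}}$ then $(t,t_0)\in\mathcal{D}_{+}$ and $\delta_{+}(t,t_0)=t$; if $t\in\mathbb{T}^{*}$ then $(t_0,t)\in\mathcal{D}_{+}$ and $\delta_{+}(t_0,t)=t$. P.4: if $(s,t)\in\mathcal{D}_{\pm}$ then $(s,\delta_{\pm}(s,t))\in\mathcal{D}_{\mp}$ and $\delta_{\mp}(s,\delta_{\pm}(s,t))=t$. P.5: if $(s,t)\in\mathcal{D}_{\pm}$ and $(u,\delta_{\pm}(s,t))\in\mathcal{D}_{\mp}$ then $(s,\delta_{\mp}(u,t))\in\mathcal{D}_{\pm}$ and $\delta_{\mp}(u,\delta_{\pm}(s,t))=\delta_{\pm}(s,\delta_{\mp}(u,t))$. Delay function. $\mathbb{T}$ is unbounded above, $h\in(t_0,\infty)_{\mathbb{T}}$ is a constant such that $(h,t)\in\mathcal{D}_{\pm}$ for all $t\in[t_0,\infty)_{\mathbb{T}}$,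 the function $t\mapsto\delta_{-}(h,t)$ is delta differentiable with rd-continuous derivative $\delta_{-}^{\Delta}(h,t)$, is strictly increasing, and maps $[t_0,\infty)_{\mathbb{T}}$ onto $[\delta_{-}(h,t_0),\infty)_{\mathbb{T}}$; its inverse is $\delta_{+}(h,\cdot)$. Standing assumptions: $t_0\ge 0$; $a,b:\mathbb{T}\to\mathbb{R}$ are rd-continuous; $|\delta_{-}^{\Delta}(h,t)|\le M<\infty$ for all $t\in[t_0,\infty)_{\mathbb{T}}$. For an rd-continuous initial function $\psi:[\delta_{-}(h,t_0),t_0]_{\mathbb{T}}\to\mathbb{R}$, $x(t,t_0,\psi)$ denotes the solution of (E) on $[t_0,\infty)_{\mathbb{T}}$ with $x=\psi$ on $[\delta_{-}(h,t_0),t_0]_{\mathbb{T}}$, and $\|\psi\|=\sup\{|\psi(t)|:t\in[\delta_{-}(h,t_0),t_0]_{\mathbb{T}}\}$. The hypothesis on $D$ is understood to include $b(\delta_{+}(h,t))\neq0$. The zero solution is stable if for every $\varepsilon>0$ there is $r>0$ such that $\|\psi\|<r$ implies $|x(t,t_0,\psi)|<\varepsilon$ for all $t\in[t_0,\infty)_{\mathbb{T}}$; it is unstable if it is not stable. *)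

(* Defs.v *)
From HB Require Import structures.
From mathcomp Require Import all_boot all_order all_algebra.
From mathcomp Require Import all_classical all_reals all_analysis.

Set Implicit Arguments.
Unset Strict Implicit.
Unset Printing Implicit Defensive.

Import Order.TTheory GRing.Theory Num.Theory.
Import numFieldNormedType.Exports.

Local Open Scope classical_set_scope.
Local Open Scope ring_scope.

(* Functions on (a part of) a time scale are represented by total functions   *)
(* R -> R of which only the values on that part are ever used.                *)

Definition time_scale (R : realType) (T : set R) : Prop :=
  T !=set0 /\ closed T.

Definition ts_ge (R : realType) (T : set R) (c : R) : set R :=
  T `&` [set t | c <= t].

Definition ts_cc (R : realType) (T : set R) (c d : R) : set R :=
  T `&` [set t | c <= t <= d].

(* [inf set0] is 0 in the library, so the jump operator is only meaningful at *)
(* points that are not the maximum of T; it is used below for time scales     *)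
(* that are unbounded above.                                                  *)
Definition sigma (R : realType) (T : set R) (t : R) : R :=
  inf [set s | T s /\ t < s].

Definition right_dense (R : realType) (T : set R) (t : R) : Prop :=
  (exists2 s, T s & t < s) /\ sigma T t = t.

Definition left_dense (R : realType) (T : set R) (t : R) : Prop :=
  (exists2 s, T s & s < t) /\ sup [set s | T s /\ s < t] = t.

(* f is rd-continuous on the subset A of T: the points of A are classified as *)
(* dense or not with respect to T, while the limits are taken along A.        *)
Definition rd_continuous (R : realType) (T A : set R) (f : R -> R) : Prop :=
  forall t, A t ->
    (right_dense T t -> f s @[s --> within A (nbhs t)] --> f t) /\
    (left_dense T t ->
      exists l : R, f s @[s --> within (A `&` [set s | s < t]) (nbhs t)] --> l).

Definition is_delta_derive (R : realType) (T : set R) (f : R -> R) (t d : R) :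
    Prop :=
  forall e : R, 0 < e -> \forall s \near t, T s ->
    `|f (sigma T t) - f s - d * (sigma T t - s)| <= e * `|sigma T t - s|.

Definition delta_derive (R : realType) (T : set R) (f : R -> R) (t : R) : R :=
  get [set d | is_delta_derive T f t d].

(* T has no maximum, hence T^kappa = T, wherever this is used. *)
Definition is_delta_antiderivative (R : realType) (T : set R)
    (F f : R -> R) : Prop :=
  forall t, T t -> is_delta_derive T F t (f t).

(* Cauchy delta integral. *)
Definition delta_integral (R : realType) (T : set R) (f : R -> R) (c d : R) :
    R :=
  get [set I | exists2 F, is_delta_antiderivative T F f & I = F d - F c].

(* A partial binary operator; its values outside [shift_dom] are irrelevant. *)
Record shift_op (R : realType) := ShiftOp {
  shift_fun :> R -> R -> R;
  shift_dom : set (R * R) }.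

(* Only pairs at which the operator is defined with value in Ts are kept. *)
Definition shift_D (R : realType) (T Ts : set R) (t0 : R) (d : shift_op R) :
    set (R * R) :=
  [set p | [/\ ts_ge T t0 p.1, Ts p.2, shift_dom d p & Ts (d p.1 p.2)]].

Definition shift_incr2 (R : realType) (D : set (R * R)) (d : shift_op R) :
    Prop :=
  forall T0 t u, D (T0, t) -> D (T0, u) -> T0 <= t -> t < u -> d T0 t < d T0 u.

Definition shift_cancel (R : realType) (D D' : set (R * R))
    (d d' : shift_op R) : Prop :=
  forall s t, D (s, t) -> D' (s, d s t) /\ d' s (d s t) = t.

Definition shift_comm (R : realType) (D D' : set (R * R))
    (d d' : shift_op R) : Prop :=
  forall s t u, D (s, t) -> D' (u, d s t) ->
    D (s, d' u t) /\ d' u (d s t) = d s (d' u t).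

Record shift_operators (R : realType) (T Ts : set R) (t0 : R)
    (dm dp : shift_op R) : Prop := ShiftOperators {
  shift_Ts_sub : Ts `<=` T;
  shift_Ts_t0 : Ts t0;
  shift_P1m : shift_incr2 (shift_D T Ts t0 dm) dm;
  shift_P1p : shift_incr2 (shift_D T Ts t0 dp) dp;
  shift_P2m : forall T1 T2 u,
    shift_D T Ts t0 dm (T1, u) -> shift_D T Ts t0 dm (T2, u) ->
    T1 < T2 -> dm T2 u < dm T1 u;
  shift_P2p : forall T1 T2 u,
    shift_D T Ts t0 dp (T1, u) -> shift_D T Ts t0 dp (T2, u) ->
    T1 < T2 -> dp T1 u < dp T2 u;
  shift_P3l : forall t, ts_ge T t0 t ->
    shift_D T Ts t0 dp (t, t0) /\ dp t t0 = t;
  shift_P3r : forall t, Ts t ->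
    shift_D T Ts t0 dp (t0, t) /\ dp t0 t = t;
  shift_P4p : shift_cancel (shift_D T Ts t0 dp) (shift_D T Ts t0 dm) dp dm;
  shift_P4m : shift_cancel (shift_D T Ts t0 dm) (shift_D T Ts t0 dp) dm dp;
  shift_P5p : shift_comm (shift_D T Ts t0 dp) (shift_D T Ts t0 dm) dp dm;
  shift_P5m : shift_comm (shift_D T Ts t0 dm) (shift_D T Ts t0 dp) dm dp }.

(* The map [dm h] lives on [t0, oo)_T, so its delta derivative is taken in    *)
(* that time scale (a right derivative at t0 if t0 is right-dense).           *)
Record delay_function (R : realType) (T Ts : set R) (t0 : R)
    (dm dp : shift_op R) (h : R) : Prop := DelayFunction {
  delay_h : T h /\ t0 < h;
  delay_Dm : forall t, ts_ge T t0 t -> shift_D T Ts t0 dm (h, t);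
  delay_Dp : forall t, ts_ge T t0 t -> shift_D T Ts t0 dp (h, t);
  delay_derivable : forall t, ts_ge T t0 t ->
    exists d, is_delta_derive (ts_ge T t0) (dm h) t d;
  delay_rd : rd_continuous T (ts_ge T t0)
    (delta_derive (ts_ge T t0) (dm h));
  delay_incr : forall t u, ts_ge T t0 t -> ts_ge T t0 u ->
    t < u -> dm h t < dm h u;
  delay_onto : dm h @` ts_ge T t0 = ts_ge T (dm h t0);
  delay_invl : forall t, ts_ge T t0 t -> dp h (dm h t) = t;
  delay_invr : forall t, ts_ge T (dm h t0) t -> dm h (dp h t) = t }.

(* As psi is only prescribed on the initial interval and need not be          *)
(* differentiable, the derivative of x is the one of the time scale           *)
(* [t0, oo)_T; at t0 it does not involve the values of psi to the left of t0. *)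
Definition is_solution (R : realType) (T : set R) (t0 : R) (dm : shift_op R)
    (h : R) (a b psi x : R -> R) : Prop :=
  (forall t, ts_cc T (dm h t0) t0 t -> x t = psi t) /\
  (forall t, ts_ge T t0 t ->
    is_delta_derive (ts_ge T t0) x t
      (a t * x t + b t * x (dm h t) * delta_derive (ts_ge T t0) (dm h) t)).

Definition init_norm (R : realType) (T : set R) (t0 : R) (dm : shift_op R)
    (h : R) (psi : R -> R) : R :=
  sup [set `|psi t| | t in ts_cc T (dm h t0) t0].

(* Quantifying over all solutions x is the same as speaking of the solution   *)
(* with initial function psi, by existence and uniqueness; the existence is   *)
(* not assumed, hence instability does assert that a solution escapes.        *)
Definition zero_stable (R : realType) (T : set R) (t0 : R) (dm : shift_op R)
    (h : R) (a b : R -> R) : Prop :=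
  forall e : R, 0 < e -> exists2 r : R, 0 < r &
    forall psi x : R -> R,
      rd_continuous T (ts_cc T (dm h t0) t0) psi ->
      is_solution T t0 dm h a b psi x ->
      init_norm T t0 dm h psi < r ->
      forall t, ts_ge T t0 t -> `|x t| < e.

Definition zero_unstable (R : realType) (T : set R) (t0 : R)
    (dm : shift_op R) (h : R) (a b : R -> R) : Prop :=
  ~ zero_stable T t0 dm h a b.

(* Main.v *)
(** Lyapunov functional: with [B s = b (dp h s)], the quantity
    [z t = x t + \int_(dm h t)^t B x] satisfies [z^Delta = Q x], and
    [L t = z t ^ 2 - D \int_(dm h t)^t (B x) ^ 2] satisfies
    [L^Delta >= Q L >= D B ^ 2 L] by Cauchy-Schwarz and [t - dm h t <= beta0 < D].
    So if [L t0 > 0] then [L] tends to infinity with [\int B ^ 2], while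
    [(D - beta0) L <= D x ^ 2]; hence [x] is unbounded.  The initial functions
    [psi t = c * expR (l * (t - t0))] have [L t0 > 0] for large [l], however
    small [c] is, because they concentrate at [t0].  That a solution with
    initial function [psi] exists at all is proved by Picard iteration, using
    antiderivatives obtained as suprema of subsolutions. *)

Require Import Defs.
From HB Require Import structures.
From mathcomp Require Import all_boot all_order all_algebra.
From mathcomp Require Import all_classical all_reals all_analysis.
From mathcomp Require Import ring lra.

Set Implicit Arguments.
Unset Strict Implicit.
Unset Printing Implicit Defensive.

Import Order.TTheory GRing.Theory Num.Theory.
Import numFieldNormedType.Exports.

Local Open Scope classical_set_scope.
Local Open Scope ring_scope.

(** Two scales are in play: the equation lives on [[t0, oo)], while the history of [x] reaches back
    to [V = [dm h t0, oo)], and the delay maps the first onto the second. The delicate step is to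
    differentiate [F (dm h t)], because the chain rule fails on time scales in general; it holds
    here because an increasing continuous bijection between the two scales commutes with their jump
    operators. The weight [B] is made so that [B (dm h t) = b t], which cancels the delayed term of
    the equation. Integrals over [[dm h t, t]] are handled as increments of antiderivatives on [V].
    The estimates on them all rest on one comparison principle, [delta_barrier], which plays the
    part of the mean value theorem. No exponential function of the time scale enters: once [L] stays
    above [L t0], its derivative dominates [L t0 * D * B ^ 2], and linear growth in the integral of
    [B ^ 2] is enough. Stability is contradicted at tolerance 1: a bound on [x] would bound that
    integral. *)

(** * Jumps and continuity on unbounded time scales *)

(** Nonemptiness is included, since the empty set is bounded above. Without a maximum, [sigma] is
    everywhere the infimum of a nonempty set, so the default value of [inf] never occurs. *)
Definition unbounded_scale (R : realType) (U : set R) : Prop :=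
  closed U /\ ~ has_ubound U.

Definition ts_continuous (R : realType) (U : set R) (f : R -> R) (t : R) : Prop :=
  f s @[s --> within U (nbhs t)] --> f t.

Lemma near_dist (R : realType) (t : R) (P : R -> Prop) :
  (\forall s \near t, P s) <->
  exists2 r : R, 0 < r & forall s, `|t - s| < r -> P s.
Proof. by split=> [/nbhs_ballP|?]; last exact/nbhs_ballP. Qed.

Lemma ts_continuousP (R : realType) (U : set R) (f : R -> R) (t : R) :
  ts_continuous U f t <->
  forall e, 0 < e -> exists2 r, 0 < r &
    forall s, U s -> `|t - s| < r -> `|f t - f s| < e.
Proof.
split=> [/cvgrPdist_lt cf e e0|cf].
  have := cf e e0; rewrite near_withinE => /near_dist[r r0 H].
  by exists r => // s Us ts; apply: H.
apply/cvgrPdist_lt => e e0; rewrite near_withinE; apply/near_dist.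
by have [r r0 H] := cf e e0; exists r => // s ts Us; apply: H.
Qed.

Lemma ts_continuous_comp (R : realType) (U V : set R) (f g : R -> R) (t : R) :
  (forall s, U s -> V (g s)) -> ts_continuous U g t ->
  ts_continuous V f (g t) -> ts_continuous U (fun s => f (g s)) t.
Proof.
move=> UV /ts_continuousP cg /ts_continuousP cf; apply/ts_continuousP => e e0.
have [r r0 fr] := cf e e0; have [q q0 gq] := cg r r0.
by exists q => // s Us ts; apply: fr; [exact: UV|exact: gq].
Qed.

Lemma ts_continuous_sub (R : realType) (U V : set R) (f : R -> R) (t : R) :
  V `<=` U -> ts_continuous U f t -> ts_continuous V f t.
Proof.
move=> VU /ts_continuousP cf; apply/ts_continuousP => e /cf[r r0 H].
by exists r => // s /VU; apply: H.
Qed.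

Lemma closed_sup (R : realType) (U A : set R) :
  closed U -> A `<=` U -> A !=set0 -> has_ubound A -> U (sup A).
Proof.
move=> cU AU A0 ubA; apply: cU; apply: closureS AU _ _.
exact: closure_sup.
Qed.

Lemma closed_inf (R : realType) (U A : set R) :
  closed U -> A `<=` U -> A !=set0 -> has_lbound A -> U (inf A).
Proof.
move=> cU AU A0 lbA; apply: cU => N /nbhs_ballP[e /= e0 eN].
have [y Ay yl] := inf_adherent e0 (conj A0 lbA).
exists y; split; [exact: AU|apply: eN; rewrite /ball /=].
by rewrite distrC ger0_norm ?subr_ge0 ?ge_inf//; lra.
Qed.

Lemma unbounded_gt (R : realType) (U : set R) (t : R) :
  unbounded_scale U -> exists2 s, U s & t < s.
Proof. by move=> [_ /has_ubPn/(_ t)]. Qed.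

Lemma sigma_in (R : realType) (U : set R) (t : R) :
  unbounded_scale U -> U (sigma U t).
Proof.
move=> nU; apply: (@closed_inf _ U _ nU.1); first by move=> s [].
  by have [s Us ts] := unbounded_gt t nU; exists s.
by exists t => s [_ /ltW].
Qed.

Lemma sigma_ge (R : realType) (U : set R) (t : R) :
  unbounded_scale U -> t <= sigma U t.
Proof.
move=> nU; apply: lb_le_inf; last by move=> s [_ /ltW].
by have [s Us ts] := unbounded_gt t nU; exists s.
Qed.

Lemma sigma_le (R : realType) (U : set R) (t s : R) :
  U s -> t < s -> sigma U t <= s.
Proof. by move=> Us ts; apply: ge_inf => //; exists t => r [_ /ltW]. Qed.

Lemma sigma_dense_gt (R : realType) (U : set R) (t e : R) :
  unbounded_scale U -> sigma U t = t -> 0 < e -> exists2 s, U s & t < s < t + e.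
Proof.
move=> nU st e0; have [] := @inf_lt _ [set s | U s /\ t < s] (t + e).
- by have [s Us ts] := unbounded_gt t nU; exists s.
- by rewrite -/(sigma U t) st ltrDl.
by move=> s [Us ts] se; exists s => //; rewrite ts se.
Qed.

(** * Delta derivatives and the barrier principle *)

(** Subtracting the defining inequality at [t] itself from the one at [s] cancels [F (sigma U t)]
    and leaves [F t - F s]. The tolerance [e1] absorbs the graininess [m], which does not shrink as
    [s] tends to [t]. *)
Lemma delta_derive_continuous (R : realType) (U : set R) (F : R -> R) (t d : R) :
  U t -> is_delta_derive U F t d -> ts_continuous U F t.
Proof.
move=> Ut dF; apply/ts_continuousP => e e0.
pose m := `|sigma U t - t|; have m0 : 0 <= m by exact: normr_ge0.
pose e1 := Num.min 1 (e / (4 * (m + 1))).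
have e10 : 0 < e1 by rewrite lt_min ltr01 divr_gt0//; lra.
have e11 : e1 <= 1 by rewrite ge_min lexx.
have e1e : e1 * (4 * (m + 1)) <= e.
  by rewrite -ler_pdivlMr ?ge_min ?lexx ?orbT//; lra.
have /near_dist[r r0 H] := dF e1 e10.
pose q := e / (4 * (1 + `|d|)).
have d0 := normr_ge0 d.
have q0 : 0 < q by rewrite divr_gt0//; lra.
have qe : q * (4 * (1 + `|d|)) = e by rewrite divfK//; apply: lt0r_neq0; lra.
exists (Num.min r q); first by rewrite lt_min r0.
move=> s Us; rewrite lt_min => /andP[tsr tsq].
have H1 := H s tsr Us.
have H2 : `|F (sigma U t) - F t - d * (sigma U t - t)| <= e1 * m.
  by apply: H => //; rewrite subrr normr0.
have H3 : `|sigma U t - s| <= m + `|t - s|.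
  by rewrite (_ : _ - s = (sigma U t - t) + (t - s)) ?ler_normD//; ring.
have H4 : `|d * (t - s)| <= `|d| * q by rewrite normrM ler_wpM2l// ltW.
have H5 : e1 * `|sigma U t - s| <= e1 * (m + `|t - s|) by rewrite ler_wpM2l// ltW.
have H6 : e1 * `|t - s| <= q.
  apply: (le_trans (y := 1 * `|t - s|)); last by rewrite mul1r ltW.
  by rewrite ler_wpM2r.
have -> : F t - F s = (F (sigma U t) - F s - d * (sigma U t - s))
  - (F (sigma U t) - F t - d * (sigma U t - t)) + d * (t - s) by ring.
apply: le_lt_trans (ler_normD _ _) _.
apply: le_lt_trans (lerD (ler_normB _ _) (lexx _)) _.
have : 0 <= e1 * m by rewrite mulr_ge0// ltW.
nra.
Qed.

(** The point [s = t] belongs to every neighbourhood, so the defining inequality holds there with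
    every tolerance and becomes an equality. *)
Lemma delta_derive_sigma (R : realType) (U : set R) (F : R -> R) (t d : R) :
  U t -> is_delta_derive U F t d ->
  F (sigma U t) = F t + d * (sigma U t - t).
Proof.
move=> Ut dF; apply/eqP; rewrite -subr_eq0 -normr_le0.
apply/ler_addgt0Pl => e e0; rewrite addr0.
set m := `|sigma U t - t|; have m0 : 0 <= m by exact: normr_ge0.
have e1 : 0 < e / (m + 1) by rewrite divr_gt0//; lra.
have /near_dist[r r0 /(_ t)] := dF _ e1.
rewrite subrr normr0 => /(_ r0 Ut); rewrite opprD addrA -/m => /le_trans; apply.
by rewrite -mulrA ler_piMr ?(ltW e0)// mulrC ler_pdivrMr; lra.
Qed.

(* The supremum of the times up to which [V >= k] can neither be reached by a *)
(* jump nor be right-dense.                                                   *)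
Lemma delta_barrier (R : realType) (U : set R) (V v : R -> R) (c d k : R) :
  unbounded_scale U -> U c -> (forall t, U t -> c <= t) -> U d ->
  (forall t, U t -> is_delta_derive U V t (v t)) ->
  k <= V c -> (forall t, U t -> t < d -> k <= V t -> 0 < v t) -> k <= V d.
Proof.
move=> nU Uc cU Ud dV Vc vpos; rewrite leNgt; apply/negP => Vd.
pose A := [set s | [/\ U s, s <= d & forall r, U r -> r <= s -> k <= V r]].
have Ac : A c.
  split=> //; first exact: cU.
  move=> r Ur rc; suff -> : r = c by []; apply/eqP; rewrite eq_le rc; exact: cU.
have ubA : has_ubound A by exists d => s [].
have A0 : A !=set0 by exists c.
pose m := sup A.
have Um : U m by apply: (closed_sup nU.1 _ A0 ubA) => s [].
have md : m <= d by apply: ge_sup => // s [].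
have below r : U r -> r < m -> k <= V r.
  by move=> Ur /(sup_gt A0)[s [_ _ As] rs]; apply: As => //; exact: ltW.
have Vm : k <= V m.
  rewrite leNgt; apply/negP => Vmk.
  have /ts_continuousP/(_ (k - V m)) := delta_derive_continuous Um (dV m Um).
  rewrite subr_gt0 => /(_ Vmk)[r r0 H].
  have [s AAs] := sup_adherent r0 (conj A0 ubA); rewrite -/m => ms.
  have sm : s <= m by exact: ub_le_sup.
  have [Us _ As] := AAs.
  have ks : k <= V s by exact: As.
  have : `|V m - V s| < k - V m.
    by apply: H => //; rewrite ger0_norm ?subr_ge0//; lra.
  by rewrite distrC => /ltr_normlW; lra.
have Am q : U q -> m < q -> q <= d -> exists2 r, U r & m < r <= q /\ V r < k.
  move=> Uq mq qd; apply: contrapT => H.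
  have : A q.
    split=> // r Ur rq; have [rm|mr|->//] := ltgtP r m; first exact: below.
    rewrite leNgt; apply/negP => Vr; apply: H; exists r => //.
    by rewrite mr rq.
  by move/(ub_le_sup ubA); rewrite leNgt mq.
have {}md : m < d.
  by rewrite lt_neqAle md andbT; apply/eqP => mdE; move: Vm; rewrite mdE leNgt Vd.
have vm := vpos m Um md Vm.
have := sigma_ge m nU; rewrite le_eqVlt => /orP[/eqP sm|sm].
  (* The tolerance is the slope [v m] itself: it already forces [V s >= V m] for [s] slightly to the
     right of [m]. *)
  have /near_dist[r r0 H] := dV m Um _ vm.
  have dm0 : 0 < Num.min r (d - m) by rewrite lt_min r0 subr_gt0.
  have [q Uq /andP[mq]] := sigma_dense_gt nU (esym sm) dm0.
  rewrite -ltrBlDl lt_min => /andP[qr qd].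
  have [s Us [/andP[ms sq] Vs]] := Am q Uq mq (ltW (ltac:(lra) : q < d)).
  have := H s; rewrite -sm distrC gtr0_norm ?subr_gt0//.
  move=> /(_ _ Us); rewrite ler_norml; have : s - m < r by lra.
  by move=> -> /(_ isT)/andP[]; nra.
have [s Us [/andP[ms sq] Vs]] := Am _ (sigma_in m nU) sm (sigma_le Ud md).
have ssm : s = sigma U m by apply/eqP; rewrite eq_le sq sigma_le.
have := delta_derive_sigma Um (dV m Um); rewrite -ssm; nra.
Qed.

(** * Rules of delta differentiation *)

Lemma delta_derive_le (R : realType) (U : set R) (F : R -> R) (t d C : R) :
  (forall e : R, 0 < e -> exists2 r : R, 0 < r & forall s, U s -> `|t - s| < r ->
    `|F (sigma U t) - F s - d * (sigma U t - s)| <= C * e * `|sigma U t - s|) ->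
  is_delta_derive U F t d.
Proof.
move=> H e e0; apply/near_dist; pose K := `|C| + 1.
have K0 : 0 < K by rewrite /K; have := normr_ge0 C; lra.
have [r r0 Hr] := H (e / K) (divr_gt0 e0 K0); exists r => // s ts Us.
apply: le_trans (Hr s Us ts) _; rewrite ler_wpM2r//.
rewrite mulrA ler_pdivrMr// mulrC ler_wpM2l ?(ltW e0)//.
by rewrite /K; have := ler_norm C; lra.
Qed.

Lemma delta_derive_ext (R : realType) (U : set R) (F G : R -> R) (t d : R) :
  unbounded_scale U -> (forall s, U s -> F s = G s) ->
  is_delta_derive U F t d -> is_delta_derive U G t d.
Proof.
move=> nU FG dF e e0; have /near_dist[r r0 H] := dF e e0.
apply/near_dist; exists r => // s ts Us.
by rewrite -!FG//; [exact: H|exact: sigma_in].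
Qed.

Lemma delta_deriveD (R : realType) (U : set R) (F G : R -> R) (t d1 d2 : R) :
  is_delta_derive U F t d1 -> is_delta_derive U G t d2 ->
  is_delta_derive U (fun s => F s + G s) t (d1 + d2).
Proof.
move=> dF dG; apply: (@delta_derive_le _ _ _ _ _ 2) => e e0.
have /near_dist[r r0 Fr] := dF e e0; have /near_dist[q q0 Gq] := dG e e0.
exists (Num.min r q); first by rewrite lt_min r0.
move=> s Us; rewrite lt_min => /andP[tr tq].
have := lerD (Fr s tr Us) (Gq s tq Us); rewrite -mulrDl -mulr2n mulr_natl.
apply: le_trans; apply: le_trans (ler_normD _ _); rewrite le_eqVlt.
by apply/orP; left; apply/eqP; congr (`| _ |); ring.
Qed.

Lemma delta_deriveZ (R : realType) (U : set R) (F : R -> R) (t d k : R) :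
  is_delta_derive U F t d -> is_delta_derive U (fun s => k * F s) t (k * d).
Proof.
move=> dF; apply: (@delta_derive_le _ _ _ _ _ `|k|) => e e0.
have /near_dist[r r0 Fr] := dF e e0; exists r => // s Us ts.
by rewrite -mulrA -!mulrBr normrM -mulrA ler_wpM2l// Fr.
Qed.

Lemma delta_deriveB (R : realType) (U : set R) (F G : R -> R) (t d1 d2 : R) :
  is_delta_derive U F t d1 -> is_delta_derive U G t d2 ->
  is_delta_derive U (fun s => F s - G s) t (d1 - d2).
Proof.
move=> dF dG; have {}dG := @delta_deriveZ _ _ _ _ _ (-1) dG.
have := delta_deriveD dF dG; rewrite mulN1r.
rewrite (_ : (fun s => _ + _) = fun s => F s - G s)//.
by apply/funext => s; rewrite mulN1r.
Qed.

Lemma delta_derive_cst (R : realType) (U : set R) (k t : R) :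
  is_delta_derive U (fun=> k) t 0.
Proof.
move=> e e0; apply/near_dist; exists 1 => // s _ _.
by rewrite subrr mul0r subr0 normr0 mulr_ge0// ltW.
Qed.

Lemma delta_derive_id (R : realType) (U : set R) (t : R) :
  is_delta_derive U id t 1.
Proof.
move=> e e0; apply/near_dist; exists 1 => // s _ _.
by rewrite mul1r subrr normr0 mulr_ge0// ltW.
Qed.

(** The factor is [F t + F (sigma U t)] instead of [2 * F t], as in the product rule on time scales.
    The difference produces a term with the graininess in the derivative of the functional, and that
    term has a favourable sign. *)
Lemma delta_derive_sqr (R : realType) (U : set R) (F : R -> R) (t d : R) :
  U t -> is_delta_derive U F t d ->
  is_delta_derive U (fun s => F s ^+ 2) t (d * (F t + F (sigma U t))).
Proof.
move=> Ut dF; pose C := `|F (sigma U t)| + `|F t| + 1 + `|d|.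
apply: (@delta_derive_le _ _ _ _ _ C) => e e0.
have e10 : 0 < Num.min 1 e by rewrite lt_min ltr01.
have /near_dist[r r0 Fr] := dF e e0.
have /ts_continuousP/(_ _ e10)[q q0 Fq] := delta_derive_continuous Ut dF.
exists (Num.min r q); first by rewrite lt_min r0.
move=> s Us; rewrite lt_min => /andP[tr tq].
have {Fr} H1 := Fr s tr Us.
have := Fq s Us tq; rewrite lt_min => /andP[H2 H3].
set y := F (sigma U t); set m := sigma U t - s.
have -> : y ^+ 2 - F s ^+ 2 - d * (F t + y) * m =
  (y - F s - d * m) * (y + F s) + d * m * (F s - F t) by ring.
have Fs : `|F s| <= `|F t| + 1.
  rewrite (_ : F s = F t - (F t - F s)); last by ring.
  by apply: le_trans (ler_normB _ _) _; lra.
apply: le_trans (ler_normD _ _) _; rewrite !normrM.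
have -> : C * e * `|m| = e * `|m| * (`|y| + (`|F t| + 1)) + `|d| * `|m| * e.
  by rewrite /C -/y; ring.
apply: lerD; last first.
  rewrite (distrC (F s)); apply: ler_wpM2l; [exact: mulr_ge0|exact: ltW].
by apply: ler_pM => //; apply: le_trans (ler_normD _ _) _; rewrite -/y; lra.
Qed.

(** The chain rule fails on time scales in general. Here [g] carries the jump at [t] to the jump at
    [g t], so the increment of [g] up to [sigma U t] is the one that the derivative of [F] at [g t]
    refers to. *)
Lemma delta_derive_comp (R : realType) (U V : set R) (F g : R -> R)
    (t d1 d2 : R) :
  (forall s, U s -> V (g s)) -> U t -> sigma V (g t) = g (sigma U t) ->
  is_delta_derive U g t d1 -> is_delta_derive V F (g t) d2 ->
  is_delta_derive U (fun s => F (g s)) t (d2 * d1).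
Proof.
move=> UV Ut sg dg dF; pose C := `|d1| + 1 + `|d2|.
apply: (@delta_derive_le _ _ _ _ _ C) => e e0.
have e10 : 0 < Num.min 1 e by rewrite lt_min ltr01.
have /near_dist[r r0 gr] := dg _ e10.
have /near_dist[p p0 Fp] := dF e e0.
have /ts_continuousP/(_ p p0)[q q0 gq] := delta_derive_continuous Ut dg.
exists (Num.min r q); first by rewrite lt_min r0.
move=> s Us; rewrite lt_min => /andP[tr tq].
have := Fp (g s) (gq s Us tq) (UV s Us); have := gr s tr Us; rewrite sg.
set m := sigma U t - s; set n := g (sigma U t) - g s => H1 H2.
have H1e : `|n - d1 * m| <= e * `|m|.
  by apply: le_trans H1 _; rewrite ler_wpM2r// ge_min lexx orbT.
have Hn : `|n| <= (`|d1| + 1) * `|m|.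
  rewrite (_ : n = (n - d1 * m) + d1 * m); last by ring.
  apply: le_trans (ler_normD _ _) _; rewrite mulrDl mul1r addrC normrM lerD2l.
  by apply: le_trans H1 _; rewrite ler_piMl// ge_min lexx.
rewrite (_ : _ - _ - _ = (F (g (sigma U t)) - F (g s) - d2 * n)
  + d2 * (n - d1 * m)); last by ring.
apply: le_trans (ler_normD _ _) _; rewrite normrM.
have -> : C * e * `|m| = e * ((`|d1| + 1) * `|m|) + `|d2| * (e * `|m|).
  by rewrite /C; ring.
apply: lerD; last by rewrite ler_wpM2l.
by apply: le_trans H2 _; rewrite ler_wpM2l// ltW.
Qed.

Lemma delta_derive_sub (R : realType) (U V : set R) (F : R -> R) (t d : R) :
  V `<=` U -> sigma V t = sigma U t ->
  is_delta_derive U F t d -> is_delta_derive V F t d.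
Proof.
move=> VU st dF e e0; have /near_dist[r r0 Fr] := dF e e0.
by apply/near_dist; exists r => // s ts /VU Us; rewrite st Fr.
Qed.

Lemma sigma_ts_ge (R : realType) (U : set R) (c t : R) :
  c <= t -> sigma (ts_ge U c) t = sigma U t.
Proof.
move=> ct; rewrite /sigma; congr inf; apply/seteqP; split=> s /=.
  by move=> [[Us _] ts].
by move=> [Us ts]; split=> //; split=> //=; rewrite (le_trans ct)// ltW.
Qed.

Lemma unbounded_ts_ge (R : realType) (U : set R) (c : R) :
  unbounded_scale U -> unbounded_scale (ts_ge U c).
Proof.
move=> nU; split; first by apply: closedI nU.1 _; exact: closed_ge.
move=> [M ubM]; have [s Us] := unbounded_gt (Num.max M c) nU.
rewrite gt_max => /andP[Ms cs].
by have := ubM s (conj Us (ltW cs)); rewrite leNgt Ms.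
Qed.

(** * Comparison of increments *)

(** The barrier principle asks for a strictly positive derivative, so a line of slope [q] is added
    to [G - F]. Its total rise is at most [e]; the [+ 1] in the denominator of [q] covers
    [c = d]. *)
Lemma delta_increment_le (R : realType) (U : set R) (F G f g : R -> R) (c d : R) :
  unbounded_scale U -> U c -> U d -> c <= d ->
  (forall t, U t -> c <= t -> is_delta_derive U F t (f t)) ->
  (forall t, U t -> c <= t -> is_delta_derive U G t (g t)) ->
  (forall t, U t -> c <= t -> t < d -> f t <= g t) ->
  F d - F c <= G d - G c.
Proof.
move=> nU Uc Ud cd dF dG fg; apply/ler_addgt0Pl => e e0.
have dc1 : 0 < d - c + 1 by lra.
pose q := e / (d - c + 1); have q0 : 0 < q by exact: divr_gt0.
have qd : q * (d - c) <= e.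
  by rewrite /q -mulrA ler_piMr ?(ltW e0)// mulrC ler_pdivrMr; lra.
suff : G c - F c + q * c <= G d - F d + q * d by lra.
apply: (@delta_barrier _ (ts_ge U c) (fun t => G t - F t + q * t)
  (fun t => g t - f t + q * 1) c d).
- exact: unbounded_ts_ge.
- by split=> /=.
- by move=> t [].
- by split.
- move=> t [Ut ct]; apply: (@delta_derive_sub _ U).
  + by move=> s [].
  + exact: sigma_ts_ge.
  + apply: delta_deriveD; last exact/delta_deriveZ/delta_derive_id.
    by apply: delta_deriveB; [exact: dG|exact: dF].
- exact: lexx.
- by move=> t [Ut ct] td _; have := fg t Ut ct td; lra.
Qed.

Lemma delta_increment_norm_le (R : realType) (U : set R) (F G f g : R -> R) (c d : R) :
  unbounded_scale U -> U c -> U d -> c <= d ->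
  (forall t, U t -> c <= t -> is_delta_derive U F t (f t)) ->
  (forall t, U t -> c <= t -> is_delta_derive U G t (g t)) ->
  (forall t, U t -> c <= t -> t < d -> `|f t| <= g t) ->
  `|F d - F c| <= G d - G c.
Proof.
move=> nU Uc Ud cd dF dG fg; rewrite ler_norml; apply/andP; split; last first.
  apply: (delta_increment_le nU Uc Ud cd dF dG) => t Ut ct td.
  exact: le_trans (ler_norm _) (fg t Ut ct td).
suff : -1 * F d - -1 * F c <= G d - G c by lra.
apply: (@delta_increment_le _ U (fun t => -1 * F t) G (fun t => -1 * f t) g) => //.
  by move=> t Ut ct; apply: delta_deriveZ; exact: dF.
move=> t Ut ct td; rewrite mulN1r; apply: le_trans (fg t Ut ct td).
by rewrite -normrN ler_norm.
Qed.

(* The discriminant of a nonnegative quadratic polynomial in [k]. *)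
Lemma delta_cauchy_schwarz (R : realType) (U : set R) (F G f : R -> R) (c d : R) :
  unbounded_scale U -> U c -> U d -> c <= d ->
  (forall t, U t -> c <= t -> is_delta_derive U F t (f t)) ->
  (forall t, U t -> c <= t -> is_delta_derive U G t (f t ^+ 2)) ->
  (F d - F c) ^+ 2 <= (d - c) * (G d - G c).
Proof.
move=> nU Uc Ud cd dF dG.
have key k : 2 * k * (F d - F c) <= (G d - G c) + k ^+ 2 * (d - c).
  suff : 2 * k * F d - 2 * k * F c
      <= G d + k ^+ 2 * d - (G c + k ^+ 2 * c) by lra.
  apply: (@delta_increment_le _ U (fun t => 2 * k * F t)
    (fun t => G t + k ^+ 2 * t) (fun t => 2 * k * f t)
    (fun t => f t ^+ 2 + k ^+ 2 * 1)) => //.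
  - by move=> t Ut ct; apply: delta_deriveZ; exact: dF.
  - move=> t Ut ct; apply: delta_deriveD; first exact: dG.
    exact/delta_deriveZ/delta_derive_id.
  - by move=> t _ _ _; rewrite mulr1; have := sqr_ge0 (f t - k); nra.
move: cd; rewrite le_eqVlt => /orP[/eqP ->|cd].
  by rewrite !subrr expr0n mul0r.
have dc : 0 < d - c by lra.
have := key ((F d - F c) / (d - c)); set w := F d - F c; set y := d - c.
rewrite -subr_ge0 (_ : _ - _ = (y * (G d - G c) - w ^+ 2) / y); last first.
  by field; apply: lt0r_neq0.
by rewrite pmulr_lge0 ?invr_gt0// subr_ge0.
Qed.

(** * Exponential weights *)

(** Both bounds come from [1 + u <= expR u]: with [u = y] directly, and with [u = - y] in the form
    [expR y * (1 - y) <= 1]. *)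
Lemma expR_taylor1 (R : realType) (y : R) :
  `|y| <= 2^-1 -> `|expR y - 1 - y| <= 2 * y ^+ 2.
Proof.
rewrite ler_norml => /andP[y1 y2].
have := expR_ge1Dx y; have := expR_ge1Dx (- y); have := expR_gt0 y.
have : expR y * expR (- y) = 1 by rewrite -expRD subrr expR0.
move=> yN y0 H1 H2; rewrite ger0_norm; last by lra.
have : expR y * (1 - y) <= 1 by rewrite -[leRHS]yN; apply: ler_wpM2l; lra.
nra.
Qed.

(** At a right-scattered point the derivative is a difference quotient, at least
    [l * expR (l * (t - c))] by convexity. This lower bound lets the exponential serve as a majorant
    in comparisons of increments. *)
Lemma delta_derive_expR (R : realType) (U : set R) (l c : R) :
  unbounded_scale U -> 0 <= l ->
  exists w : R -> R, forall t, U t ->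
    is_delta_derive U (fun s => expR (l * (s - c))) t (w t)
    /\ l * expR (l * (t - c)) <= w t.
Proof.
move=> nU l0; pose E s := expR (l * (s - c)).
pose w t := if sigma U t == t then l * E t
            else (E (sigma U t) - E t) / (sigma U t - t).
have Eexp t s : E s = E t * expR (l * (s - t)).
  by rewrite /E -expRD; congr expR; ring.
have taylor t : exists2 K, 0 <= K & forall s, l * `|t - s| <= 2^-1 ->
    `|E t - E s - l * E t * (t - s)| <= K * `|t - s| ^+ 2.
  exists (E t * (2 * l ^+ 2)); first by rewrite mulr_ge0 ?expR_ge0 ?mulr_ge0 ?sqr_ge0.
  move=> s ts; rewrite (Eexp t s) (_ : _ - _ - _ =
    - (E t * (expR (l * (s - t)) - 1 - l * (s - t)))); last by ring.
  have lst : `|l * (s - t)| = l * `|t - s| by rewrite normrM (ger0_norm l0) distrC.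
  rewrite normrN normrM ger0_norm ?expR_ge0// -mulrA ler_wpM2l ?expR_ge0//.
  apply: le_trans (expR_taylor1 _) _; first by rewrite lst.
  by rewrite -real_normK ?num_real// lst exprMn mulrA.
exists w => t Ut; rewrite -/(E _) /w; split; last first.
  case: eqP => [_|/eqP st]; first exact: lexx.
  have mt : 0 < sigma U t - t by rewrite subr_gt0 lt_neqAle eq_sym st sigma_ge.
  rewrite ler_pdivlMr// (Eexp t (sigma U t)).
  have := expR_ge1Dx (l * (sigma U t - t)); have := expR_gt0 (l * (t - c)).
  rewrite -/(E t); nra.
have [K K0 tay] := taylor t.
have l1 : 0 < l + 1 by lra.
case: eqP => [st|/eqP st].
  apply: (@delta_derive_le _ _ _ _ _ 1) => e e0; rewrite st mul1r.
  exists (Num.min (2^-1 / (l + 1)) (e / (K + 1))).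
    by rewrite lt_min !divr_gt0//; lra.
  move=> s Us; rewrite lt_min ltr_pdivlMr// ltr_pdivlMr; last by lra.
  move=> /andP[H1 H2]; have n0 := normr_ge0 (t - s).
  by apply: le_trans (tay s _) _; nra.
have mt : 0 < sigma U t - t by rewrite subr_gt0 lt_neqAle eq_sym st sigma_ge.
set m := sigma U t - t; set k := (_ / m).
(* Near a right-scattered point [|sigma U t - s|] is at least [m], so an error of order [|t - s|] is
   small relative to it, at the price of the factor [1 / m]. *)
pose C := (K + `|l * E t| + `|k|) / m.
apply: (@delta_derive_le _ _ _ _ _ C) => e e0.
exists (Num.min (Num.min (2^-1 / (l + 1)) 1) (Num.min m e)).
  by rewrite !lt_min mt e0 ltr01 !divr_gt0//; lra.
move=> s Us; rewrite !lt_min ltr_pdivlMr// => /andP[/andP[H1 H2]/andP[H3 H4]].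
have n0 := normr_ge0 (t - s).
have st' : s <= t.
  rewrite leNgt; apply/negP => ts; have := sigma_le Us ts.
  by move: H3; rewrite distrC gtr0_norm ?subr_gt0// /m; lra.
rewrite (_ : E (sigma U t) - E s - k * (sigma U t - s) =
  (E t - E s - l * E t * (t - s)) + (l * E t) * (t - s) - k * (t - s)); last first.
  rewrite /k -/m (_ : sigma U t - s = m + (t - s)); last by rewrite /m; ring.
  by field; apply: lt0r_neq0.
apply: le_trans (ler_normB _ _) _.
apply: le_trans (lerD (ler_normD _ _) (lexx _)) _; rewrite (normrM (l * E t)) (normrM k).
have := tay s; have lts : l * `|t - s| <= 2^-1 by nra.
move=> /(_ lts) H5.
have ms : m <= `|sigma U t - s|.
  by rewrite ger0_norm; move: mt; rewrite /m; lra.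
apply: (@le_trans _ _ ((K + `|l * E t| + `|k|) * e)).
  have H6 : K * `|t - s| ^+ 2 <= K * e.
    by apply: ler_wpM2l => //; rewrite expr2; nra.
  have H7 : `|l * E t| * `|t - s| <= `|l * E t| * e by rewrite ler_wpM2l// ltW.
  have H8 : `|k| * `|t - s| <= `|k| * e by rewrite ler_wpM2l// ltW.
  by rewrite !mulrDl; lra.
rewrite (_ : C * e * _ =
  (K + `|l * E t| + `|k|) * e * (`|sigma U t - s| / m)); last first.
  by rewrite /C; ring.
rewrite ler_peMr ?ler_pdivlMr ?mul1r//.
by rewrite mulr_ge0 ?(ltW e0)// !addr_ge0.
Qed.

(** * Local boundedness *)

Lemma norm_le_dist (R : realType) (x y e : R) :
  `|x - y| < e -> `|y| <= `|x| + e.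
Proof.
have := ler_normB x (x - y); rewrite (_ : x - (x - y) = y); last by ring.
lra.
Qed.

Definition loc_bounded (R : realType) (U : set R) (f : R -> R) : Prop :=
  forall c d : R, exists K : R, forall t, U t -> c <= t <= d -> `|f t| <= K.

(** Compactness of [[c, d]] in its near-covering form, where the parameter tending to infinity is
    the bound. Around a point outside [U], the open complement of [U] makes the condition
    vacuous. *)
Lemma loc_boundedP (R : realType) (U : set R) (f : R -> R) :
  closed U ->
  (forall t, U t -> exists K, exists2 r : R, 0 < r &
     forall s, U s -> `|t - s| < r -> `|f s| <= K) ->
  loc_bounded U f.
Proof.
move=> cU H c d.
have /compact_near_coveringP/(_ R +oo (fun k t => U t -> `|f t| <= k)) :=
  @segment_compact R c d.
case=> [t _|M [_ HM]]; last first.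
  exists (M + 1) => t Ut ctd; by apply: HM => //; rewrite ltrDl.
have [Ut|nUt] := pselect (U t).
  have [K [r r0 Kr]] := H t Ut.
  exists (ball t r, [set k | K <= k]) => /=; first split.
  - exact: nbhsx_ballx.
  - by apply: nbhs_pinfty_ge; rewrite num_real.
  - by case=> s k [/= ts Kk] Us; apply: le_trans (Kr s Us ts) Kk.
exists (~` U, setT) => /=; last by case=> s k [].
by split; [exact: (open_nbhs_nbhs (conj (closed_openC cU) nUt))|exact: filterT].
Qed.

Lemma ts_continuous_loc_bounded (R : realType) (U : set R) (f : R -> R) :
  closed U -> (forall t, U t -> ts_continuous U f t) -> loc_bounded U f.
Proof.
move=> cU cf; apply: loc_boundedP => // t Ut.
have /ts_continuousP/(_ 1 ltr01)[r r0 H] := cf t Ut.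
exists (`|f t| + 1), r => // s Us ts; exact/norm_le_dist/H.
Qed.

(** The two sides of [t] are treated separately: on a dense side the one-sided limit gives a bound,
    and on a scattered side a small neighbourhood contains no point of [U] other than possibly
    [t]. *)
Lemma rd_continuous_loc_bounded (R : realType) (U : set R) (f : R -> R) :
  unbounded_scale U -> rd_continuous U U f -> loc_bounded U f.
Proof.
move=> nU rdf; apply: loc_boundedP nU.1 _ => t Ut.
have [rd ld] := rdf t Ut.
have [K1 [r1 r10 H1]] : exists K, exists2 r : R, 0 < r &
    forall s, U s -> t <= s -> `|t - s| < r -> `|f s| <= K.
  have := sigma_ge t nU; rewrite le_eqVlt => /orP[/eqP st|ts].
    have /cvgrPdist_lt/(_ 1 ltr01) := rd (conj (unbounded_gt t nU) (esym st)).
    rewrite near_withinE => /near_dist[r r0 H].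
    exists (`|f t| + 1), r => // s Us _ tsr; exact/norm_le_dist/H.
  exists `|f t|, (sigma U t - t); first by rewrite subr_gt0.
  move=> s Us; rewrite le_eqVlt => /orP[/eqP<- //|ls].
  rewrite distrC gtr0_norm ?subr_gt0// ltrD2r => sst.
  by have := sigma_le Us ls; rewrite leNgt sst.
have [K2 [r2 r20 H2]] : exists K, exists2 r : R, 0 < r &
    forall s, U s -> s < t -> `|t - s| < r -> `|f s| <= K.
  pose A := [set s | U s /\ s < t].
  have ubA : has_ubound A by exists t => s [_ /ltW].
  have [A0|A0] := pselect (A !=set0); last first.
    by exists 0, 1 => // s Us st _; exfalso; apply: A0; exists s.
  have : sup A <= t by apply: ge_sup => // s [_ /ltW].
  rewrite le_eqVlt => /orP[/eqP st|st].
    have [|l] := ld; first by split=> //; case: A0 => s [Us ?]; exists s.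
    move=> /cvgrPdist_lt/(_ 1 ltr01); rewrite near_withinE => /near_dist[r r0 H].
    exists (`|l| + 1), r => // s Us ls tsr; exact/norm_le_dist/H.
  exists 0, (t - sup A); first by rewrite subr_gt0.
  move=> s Us ls; rewrite gtr0_norm ?subr_gt0//.
  by have : s <= sup A by [exact: (ub_le_sup ubA)|]; lra.
exists (Num.max K1 K2), (Num.min r1 r2); first by rewrite lt_min r10.
move=> s Us; rewrite lt_min le_max => /andP[s1 s2].
have [ts|st] := leP t s; first by rewrite H1.
by rewrite H2 ?orbT.
Qed.

(** * Antiderivatives by Perron's method *)

(* The antiderivative of [f] is the supremum of the functions that vanish at  *)
(* [c] and whose increments on each [s, t] are at most [(t - s) * sup f].     *)
Section Perron.

Variables (R : realType) (U : set R) (c : R) (f : R -> R).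
Hypotheses (nU : unbounded_scale U) (Uc : U c) (cU : forall t, U t -> c <= t).
Hypothesis bf : loc_bounded U f.

(** The right endpoint is left out because a delta integral over [[s, t]] does not see the value at
    [t]: across a jump from [s] to [t] only [f s] counts. *)
Let below (s t M : R) : Prop := forall r, U r -> s <= r < t -> f r <= M.

Let perron (G : R -> R) : Prop := G c = 0 /\ forall s t M, U s -> U t -> s <= t ->
  below s t M -> G t - G s <= M * (t - s).

Let values (t : R) : set R := [set G t | G in perron].

Let F (t : R) : R := sup (values t).

Let belowW s t M s' t' : below s t M -> s <= s' -> t' <= t -> below s' t' M.
Proof.
move=> b ss tt r Ur /andP[r1 r2]; apply: b => //.
by rewrite (le_trans ss r1) (lt_le_trans r2 tt).
Qed.

(** The competitor is [- (k t * (t - c))], with [k t] the supremum of [|f|] up to [t]. As [k] is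
    nondecreasing, it drops between two points at a rate no smaller than any [|f|] met so far, which
    is steep enough for every admissible [M]. *)
Let values_neq0 t : values t !=set0.
Proof.
pose A d := [set `|f s| | s in [set s | U s /\ s <= d]].
have ubA d : has_ubound (A d).
  have [K HK] := bf c d; exists K => _ [s [Us sd] <-].
  by apply: HK => //; rewrite cU.
pose k d := sup (A d).
have kf s d : U s -> s <= d -> `|f s| <= k d.
  by move=> Us sd; apply: (ub_le_sup (ubA d)); exists s.
have k0 d : U d -> 0 <= k d by move=> Ud; apply: le_trans (kf d d Ud (lexx d)).
have kmono s d : U s -> s <= d -> k s <= k d.
  move=> Us sd; apply: ge_sup; first by exists `|f s|; exists s => //; split=> /=.
  by move=> _ [r [Ur rs] <-]; apply: kf => //; apply: le_trans sd.
exists (- (k t * (t - c))); exists (fun t => - (k t * (t - c))) => //.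
split; first by rewrite subrr mulr0 oppr0.
move=> {}t d M Ut Ud; rewrite le_eqVlt => /orP[/eqP->|td] bM.
  by rewrite !subrr mulr0.
have H1 : f t <= M by apply: bM; rewrite ?lexx.
have := kf t d Ut (ltW td); rewrite ler_norml => /andP[H2 _].
have := kmono t d Ut (ltW td); have := cU Ut; have := k0 t Ut.
by move: H2 H1 td; set x := k t; set y := k d; nra.
Qed.

Let values_ub t : U t -> has_ubound (values t).
Proof.
move=> Ut; have [K HK] := bf c t; exists (K * (t - c)) => _ [G [Gc GP] <-].
have := GP c t K Uc Ut (cU Ut); rewrite Gc subr0; apply=> r Ur /andP[cr rt].
by apply: le_trans (ler_norm _) (HK r Ur _); rewrite cr ltW.
Qed.

Let F_le s t M : U s -> U t -> s <= t -> below s t M -> F t - F s <= M * (t - s).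
Proof.
move=> Us Ut st bM; rewrite lerBlDl; apply: ge_sup (values_neq0 t) _.
move=> _ [G pG <-]; have := pG.2 s t M Us Ut st bM.
have : G s <= F s by apply: (ub_le_sup (values_ub Us)); exists G.
lra.
Qed.

(* A competitor is modified on [s, t] to have slope [m] and keeps its         *)
(* increments elsewhere.                                                      *)
Let F_ge s t m : U s -> U t -> s <= t ->
  (forall r, U r -> s <= r < t -> m <= f r) -> m * (t - s) <= F t - F s.
Proof.
move=> Us Ut st mf; rewrite lerBrDl -lerBrDr; apply: ge_sup (values_neq0 s) _.
move=> _ [G [Gc GP] <-]; rewrite lerBrDr; apply: (ub_le_sup (values_ub Ut)).
pose H q := if q <= s then G q else
            if q <= t then G s + m * (q - s) else G s + m * (t - s) + (G q - G t).
have Ht : H t = G s + m * (t - s).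
  rewrite /H lexx; case: ifP => // ts; have -> : t = s by apply/eqP; rewrite eq_le ts.
  by rewrite subrr mulr0 addr0.
exists H => //; split; first by rewrite /H cU.
move=> r q M Ur Uq; rewrite le_eqVlt => /orP[/eqP->|rq] bM.
  by rewrite !subrr mulr0.
(* The imposed slope [m] and the allowed slope [M] compete only where [[s, t)] and [[r, q)] share a
   point of [U], and such a point gives [m <= M]. *)
have mM p : U p -> s <= p < t -> r <= p < q -> m <= M.
  by move=> Up sp rp; apply: le_trans (mf p Up sp) (bM p Up rp).
have G1 x y : U x -> U y -> r <= x -> x <= y -> y <= q -> G y - G x <= M * (y - x).
  by move=> Ux Uy rx xy yq; apply: GP => //; exact: belowW bM _ _.
rewrite /H; have [rs|sr] := leP r s; have [qs|sq] := leP q s.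
- by apply: G1 => //; exact: ltW.
- have Grs := G1 r s Ur Us (lexx r) rs (ltW sq).
  have [qt|tq] := leP q t.
    have : m <= M by apply: (mM s); rewrite ?lexx ?rs//= (lt_le_trans sq qt).
    nra.
  have Gtq := G1 t q Ut Uq (le_trans rs st) (ltW tq) (lexx q).
  move: st; rewrite le_eqVlt => /orP[/eqP st|st].
    by move: Grs Gtq; rewrite st subrr; lra.
  have : m <= M by apply: (mM s); rewrite ?lexx ?rs//=.
  nra.
- by move: (lt_trans sr rq); rewrite ltNge qs.
- have [rt|tr] := leP r t; have [qt|tq] := leP q t.
  + have : m <= M by apply: (mM r); rewrite ?lexx ?(ltW sr)//= (lt_le_trans rq qt).
    nra.
  + have Gtq := G1 t q Ut Uq rt (ltW tq) (lexx q).
    move: rt; rewrite le_eqVlt => /orP[/eqP rt|rt]; first by move: Gtq; rewrite rt; lra.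
    have : m <= M by apply: (mM r); rewrite ?lexx ?(ltW sr).
    nra.
  + by move: (lt_trans tr rq); rewrite ltNge qt.
  + by have := G1 r q Ur Uq (lexx r) (ltW rq) (lexx q); lra.
Qed.

Let F_norm s t y k : U s -> U t -> s <= t ->
  (forall r, U r -> s <= r < t -> `|f r - y| <= k) ->
  `|F t - F s - y * (t - s)| <= k * (t - s).
Proof.
move=> Us Ut st H; rewrite ler_norml.
have := @F_le s t (y + k) Us Ut st; have := @F_ge s t (y - k) Us Ut st.
move=> H1 H2; apply/andP; split.
  suff : (y - k) * (t - s) <= F t - F s by lra.
  by apply: H1 => r Ur /(H r Ur); rewrite ler_norml => /andP[]; lra.
suff : F t - F s <= (y + k) * (t - s) by lra.
by apply: H2 => r Ur /(H r Ur); rewrite ler_norml => /andP[]; lra.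
Qed.

(** At a right-dense point [F_norm] and continuity of [f] give the derivative. At a right-scattered
    one, [t] is the only point of [[t, sigma U t)], so the increment of [F] across the jump is
    exact; to the left the bound [K] suffices, because [|sigma U t - s|] stays at least [m]. *)
Lemma delta_antiderivative_exists :
  (forall t, U t -> sigma U t = t -> ts_continuous U f t) ->
  exists2 F : R -> R, F c = 0 &
    forall t, U t -> is_delta_derive U F t (f t).
Proof.
move=> cf; exists F.
  rewrite /F (_ : values c = [set 0]) ?sup1//; apply/seteqP; split=> [_ [G [+ _] <-] //|].
  have [_ [G pG _]] := values_neq0 c.
  by move=> _ ->; exists G => //; case: pG.
move=> t Ut; have := sigma_ge t nU; rewrite le_eqVlt => /orP[/eqP st|st].
  move=> e e0; have /ts_continuousP/(_ e e0)[r r0 H] := cf t Ut (esym st).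
  apply/near_dist; exists r => // s ts Us; rewrite -st.
  move: ts; rewrite ltr_distl => /andP[t1 t2].
  have [ls|ls] := leP s t.
    rewrite [`|t - s|]ger0_norm ?subr_ge0//; apply: F_norm => // p Up /andP[p1 p2].
    by rewrite distrC; apply/ltW/H => //; rewrite ltr_distl; apply/andP; split; lra.
  rewrite distrC [`|t - s|]distrC [`|s - t|]gtr0_norm ?subr_gt0//.
  rewrite (_ : f t * (t - s) - _ = F s - F t - f t * (s - t)); last by ring.
  apply: F_norm => // [|p Up /andP[p1 p2]]; first exact: ltW.
  by rewrite distrC; apply/ltW/H => //; rewrite ltr_distl; apply/andP; split; lra.
have [K HK] := bf c t.
have K0 : 0 <= K by apply: le_trans (HK t Ut _); rewrite ?lexx ?cU.
pose m := sigma U t - t; have m0 : 0 < m by rewrite subr_gt0.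
apply: (@delta_derive_le _ _ _ _ _ (2 * K)) => e e0.
exists (Num.min m (m * e)); first by rewrite lt_min m0 mulr_gt0.
move=> s Us; rewrite lt_min => /andP[ts1 ts2].
have ls : s <= t.
  rewrite leNgt; apply/negP => ts; have := sigma_le Us ts.
  by move: ts1; rewrite distrC gtr0_norm ?subr_gt0// /m; lra.
have : `|F (sigma U t) - F t - f t * (sigma U t - t)| <= 0 * (sigma U t - t).
  apply: F_norm => //; [exact: sigma_in|exact: ltW|].
  move=> p Up /andP[]; rewrite le_eqVlt => /orP[/eqP-> _|tp].
    by rewrite subrr normr0.
  by rewrite ltNge sigma_le.
rewrite mul0r normr_le0 => /eqP H1.
have H2 : `|F t - F s - f t * (t - s)| <= 2 * K * (t - s).
  apply: F_norm => // p Up /andP[sp pt].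
  have := HK p Up; have := HK t Ut.
  rewrite lexx !cU// (ltW pt) => /(_ isT) a1 /(_ isT) a2.
  by apply: le_trans (ler_normB _ _) _; lra.
rewrite (_ : _ - _ - _ = (F (sigma U t) - F t - f t * (sigma U t - t)) +
  (F t - F s - f t * (t - s))); last by ring.
rewrite H1 add0r; apply: le_trans H2 _; rewrite -!mulrA; do 2 apply: ler_wpM2l => //.
rewrite ger0_norm; last by move: m0; rewrite /m; lra.
move: ts2; rewrite ger0_norm ?subr_ge0// /m; nra.
Qed.

End Perron.

(** * Geometric convergence and Picard iteration *)

Lemma geometric_small (R : realType) (K e : R) :
  0 < e -> exists n, K * 2^-1 ^+ n < e.
Proof.
move=> e0; have K0 : 0 <= `|K| / e by rewrite divr_ge0// ltW.
exists (Num.bound (`|K| / e)); set n := Num.bound _.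
have : `|K| / e < n%:R := archi_boundP K0.
rewrite ltr_pdivrMr// => Kn; apply: le_lt_trans (ler_norm _) _.
have h0 : (0 : R) < 2^-1 ^+ n by rewrite exprn_gt0// invr_gt0.
rewrite normrM (gtr0_norm h0).
apply: lt_le_trans (_ : n%:R * e * 2^-1 ^+ n <= _); first by rewrite ltr_pM2r.
rewrite mulrAC ler_piMl ?(ltW e0)// exprVn ler_pdivrMr ?exprn_gt0// mul1r.
by rewrite -natrX ler_nat ltnW// ltn_expl.
Qed.

(** The limit is chosen before [B], so that one pointwise choice serves all bounds. With the least
    admissible [B], the intervals of radius [2 * B * 2^-1 ^+ n] (the tail of the geometric series)
    around [y n] are nested; if no [B] is admissible, any [l] will do. *)
Lemma geometric_limit (R : realType) (y : nat -> R) :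
  exists l : R, forall B : R, (forall n, `|y n.+1 - y n| <= B * 2^-1 ^+ n) ->
    forall n, `|l - y n| <= 2 * B * 2^-1 ^+ n.
Proof.
pose h n : R := 2^-1 ^+ n.
have h0 n : 0 < h n by rewrite exprn_gt0// invr_gt0.
have hS n : h n.+1 = h n / 2 by rewrite /h exprSr.
pose A := [set `|y n.+1 - y n| / h n | n in [set: nat]].
have AB B : (forall n, `|y n.+1 - y n| <= B * h n) -> ubound A B.
  by move=> H _ [n _ <-]; rewrite ler_pdivrMr.
have A0 : A !=set0 by exists (`|y 1 - y 0| / h 0), 0%N.
have [ubA|nA] := pselect (has_ubound A); last first.
  by exists 0 => B /AB HB; exfalso; apply: nA; exists B.
pose B := sup A.
have HB n : `|y n.+1 - y n| <= B * h n.
  by rewrite -ler_pdivrMr//; apply: (ub_le_sup ubA); exists n.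
pose z n := y n - 2 * B * h n; pose u n := y n + 2 * B * h n.
have B0 : 0 <= B.
  by rewrite -(pmulr_lge0 _ (h0 0)); apply: le_trans (HB 0).
have zm : {homo z : n m / (n <= m)%N >-> n <= m}.
  apply/nondecreasing_seqP => n; rewrite /z hS.
  by have := HB n; rewrite ler_norml => /andP[]; lra.
have um : {homo u : n m / (n <= m)%N >-> m <= n}.
  apply/nonincreasing_seqP => n; rewrite /u hS.
  by have := HB n; rewrite ler_norml => /andP[]; lra.
have zu n m : z n <= u m.
  apply: le_trans (zm _ _ (leq_maxl n m)) _.
  apply: le_trans _ (um _ _ (leq_maxr n m)); rewrite /z /u.
  by have := mulr_ge0 B0 (ltW (h0 (maxn n m))); lra.
have ubz : has_ubound (range z) by exists (u 0) => _ [n _ <-].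
exists (sup (range z)) => C /AB HC n.
have BC : B <= C by exact: ge_sup.
have : 2 * B * h n <= 2 * C * h n by rewrite ler_pM2r//; lra.
have H1 : z n <= sup (range z) by apply: (ub_le_sup ubz); exists n.
have H2 : sup (range z) <= u n by apply: ge_sup => [|_ [m _ <-]//]; exists (z 0), 0.
rewrite ler_norml; move: H1 H2; rewrite /z /u -/(h n) => H1 H2 H3.
by apply/andP; split; lra.
Qed.

Lemma ts_continuousD (R : realType) (U : set R) (f g : R -> R) (t : R) :
  ts_continuous U f t -> ts_continuous U g t ->
  ts_continuous U (fun s => f s + g s) t.
Proof. by move=> cf cg; apply: cvgD. Qed.

Lemma ts_continuousM (R : realType) (U : set R) (f g : R -> R) (t : R) :
  ts_continuous U f t -> ts_continuous U g t ->
  ts_continuous U (fun s => f s * g s) t.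
Proof. by move=> cf cg; apply: cvgM. Qed.

Lemma ts_continuous_min (R : realType) (U : set R) (c t : R) :
  ts_continuous U (fun s => Num.min s c) t.
Proof.
apply/ts_continuousP => e e0; exists e => // s _; apply: le_lt_trans.
rewrite ler_norml; have := ler_norm (t - s); have := ler_norm (s - t).
by rewrite (distrC s t) => H1 H2; case: (leP t c) => H3; case: (leP s c) => H4;
  apply/andP; split; lra.
Qed.

Lemma ts_continuous_max (R : realType) (U : set R) (c t : R) :
  ts_continuous U (fun s => Num.max s c) t.
Proof.
apply/ts_continuousP => e e0; exists e => // s _; apply: le_lt_trans.
rewrite ler_norml; have := ler_norm (t - s); have := ler_norm (s - t).
by rewrite (distrC s t) => H1 H2; case: (leP t c) => H3; case: (leP s c) => H4;
  apply/andP; split; lra.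
Qed.

Lemma loc_boundedD (R : realType) (U : set R) (f g : R -> R) :
  loc_bounded U f -> loc_bounded U g -> loc_bounded U (fun s => f s + g s).
Proof.
move=> bf bg c d; have [K HK] := bf c d; have [L HL] := bg c d.
exists (K + L) => t Ut td; apply: le_trans (ler_normD _ _) _.
by rewrite lerD ?HK ?HL.
Qed.

Lemma loc_boundedM (R : realType) (U : set R) (f g : R -> R) :
  loc_bounded U f -> loc_bounded U g -> loc_bounded U (fun s => f s * g s).
Proof.
move=> bf bg c d; have [K HK] := bf c d; have [L HL] := bg c d.
by exists (K * L) => t Ut td; rewrite normrM ler_pM ?HK ?HL.
Qed.

(* Weaker than rd-continuity (no left limits are required), but sufficient    *)
(* for [delta_antiderivative_exists].                                         *)
Definition ts_regular (R : realType) (U : set R) (f : R -> R) : Prop :=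
  loc_bounded U f /\ forall t, U t -> sigma U t = t -> ts_continuous U f t.

Lemma ts_regularD (R : realType) (U : set R) (f g : R -> R) :
  ts_regular U f -> ts_regular U g -> ts_regular U (fun s => f s + g s).
Proof.
move=> [bf cf] [bg cg]; split; first exact: loc_boundedD.
by move=> t Ut st; apply: ts_continuousD; [exact: cf|exact: cg].
Qed.

Lemma ts_regularM (R : realType) (U : set R) (f g : R -> R) :
  ts_regular U f -> ts_regular U g -> ts_regular U (fun s => f s * g s).
Proof.
move=> [bf cf] [bg cg]; split; first exact: loc_boundedM.
by move=> t Ut st; apply: ts_continuousM; [exact: cf|exact: cg].
Qed.

Lemma ts_regular_continuous (R : realType) (U : set R) (f : R -> R) :
  closed U -> (forall t, U t -> ts_continuous U f t) -> ts_regular U f.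
Proof.
by move=> cU cf; split; [exact: ts_continuous_loc_bounded|move=> t Ut _; exact: cf].
Qed.

Section Picard.

Variables (R : realType) (V : set R) (t0 : R) (g A B psi : R -> R).
Hypotheses (nV : unbounded_scale V) (Vt0 : V t0).

Let U : set R := ts_ge V t0.

Hypotheses (gV : forall t, U t -> V (g t)) (g_le : forall t, U t -> g t <= t).
Hypothesis gc : forall t, U t -> ts_continuous U g t.
Hypotheses (rA : ts_regular U A) (rB : ts_regular U B).

Let cont (x : R -> R) : Prop := forall t, V t -> ts_continuous V x t.

Hypothesis cpsi : cont psi.

Let nU : unbounded_scale U. Proof. exact: unbounded_ts_ge. Qed.

Let UV : U `<=` V. Proof. by move=> t []. Qed.

Let Ut0 : U t0. Proof. by split=> /=. Qed.

Let J (f : R -> R) : R -> R :=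
  get [set F : R -> R | F t0 = 0 /\ forall t, U t -> is_delta_derive U F t (f t)].

Let J_spec f : ts_regular U f ->
  J f t0 = 0 /\ forall t, U t -> is_delta_derive U (J f) t (f t).
Proof.
move=> [bf cf]; pose P := [set F : R -> R | F t0 = 0 /\
  forall t, U t -> is_delta_derive U F t (f t)].
suff : P (get P) by [].
apply: getPex.
have [F F0 dF] := delta_antiderivative_exists nU Ut0 (fun t => @proj2 _ _) bf cf.
by exists F.
Qed.

Let N (x : R -> R) (t : R) : R := A t * x t + B t * x (g t).

Let N_regular x : cont x -> ts_regular U (N x).
Proof.
move=> cx; apply: ts_regularD; apply: ts_regularM => //;
    apply: ts_regular_continuous nU.1 _ => t Ut.
  by apply: ts_continuous_sub (cx t (UV Ut)).
by apply: ts_continuous_comp gV (gc Ut) (cx _ (gV Ut)).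
Qed.

(** Since [J (N x)] vanishes at [t0], this single formula equals [psi] to the left and
    [psi t0 + J (N x)] to the right; continuity at [t0] follows by composition, without gluing. *)
Let step (x : R -> R) (t : R) : R :=
  psi (Num.min t t0) + J (N x) (Num.max t t0).

Let step_le x t : cont x -> t <= t0 -> step x t = psi t.
Proof.
move=> cx tt0; rewrite /step min_l// max_r//.
by have [-> _] := J_spec (N_regular cx); rewrite addr0.
Qed.

Let step_ge x t : t0 <= t -> step x t = psi t0 + J (N x) t.
Proof. by move=> tt0; rewrite /step min_r// max_l. Qed.

Let max_in t : V t -> U (Num.max t t0).
Proof. by move=> Vt; split=> /=; [case: leP|rewrite le_max lexx orbT]. Qed.

Let step_cont x : cont x -> cont (step x).
Proof.
move=> cx t Vt; have [_ dJ] := J_spec (N_regular cx); apply: ts_continuousD.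
  apply: (@ts_continuous_comp _ V V psi (fun s => Num.min s t0)).
  - by move=> s Vs; case: leP.
  - exact: ts_continuous_min.
  - by apply: cpsi; case: leP.
apply: (@ts_continuous_comp _ V U (J (N x)) (fun s => Num.max s t0)).
- exact: max_in.
- exact: ts_continuous_max.
- by apply: delta_derive_continuous (max_in Vt) (dJ _ (max_in Vt)).
Qed.

(** The weight is taken at [v] while the bound covers every [s <= v] in [V]. The delayed value at
    [g r] is thus controlled by the weight at [r], even when [g r] lies before [t0]. *)
Let close (k u : R) (x y : R -> R) (C : R) : Prop :=
  forall v s, U v -> v <= u -> V s -> s <= v ->
  `|x s - y s| <= C * expR (2 * k * (v - t0)).

(* The weight [expR (2 * k * (t - t0))] makes the Picard step a contraction.  *)
Let step_close k u x y C : U u -> 0 <= k -> 0 <= C -> cont x -> cont y ->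
  (forall t, U t -> t <= u -> `|A t| + `|B t| <= k) ->
  close k u x y C -> close k u (step x) (step y) (C / 2).
Proof.
move=> Uu k0 C0 cx cy ABk xy v s Uv vu Vs sv.
have W0 r := expR_gt0 (2 * k * (r - t0)).
have [st0|t0s] := leP s t0.
  by rewrite !step_le// subrr normr0 mulr_ge0 ?(ltW (W0 v))// divr_ge0.
have Us : U s by split=> //; exact: ltW.
rewrite !step_ge ?(ltW t0s)// (_ : _ - _ = J (N x) s - J (N y) s); last by ring.
have [Jx0 dJx] := J_spec (N_regular cx); have [Jy0 dJy] := J_spec (N_regular cy).
(* The derivatives differ by at most [k * C * expR (2 * k * (r - t0))], and [w] is at least [2 * k]
   times the weight: the rate [2 * k] is what yields the contraction factor one half. *)
have [w Hw] := @delta_derive_expR _ U (2 * k) t0 nU (ltac:(by rewrite mulr_ge0)).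
have : `|(J (N x) s - J (N y) s) - (J (N x) t0 - J (N y) t0)|
    <= C / 2 * expR (2 * k * (s - t0)) - C / 2 * expR (2 * k * (t0 - t0)).
  apply: (@delta_increment_norm_le _ U (fun r => J (N x) r - J (N y) r)
    (fun r => C / 2 * expR (2 * k * (r - t0))) (fun r => N x r - N y r)
    (fun r => C / 2 * w r)) => //.
  - exact: ltW.
  - by move=> r Ur _; apply: delta_deriveB; [exact: dJx|exact: dJy].
  - by move=> r Ur _; apply: delta_deriveZ; have [] := Hw r Ur.
  move=> r Ur _ rs; have ru : r <= u by apply: le_trans (ltW rs) (le_trans sv vu).
  have [_ wr] := Hw r Ur.
  have H1 := xy r r Ur ru (UV Ur) (lexx r).
  have H2 := xy r (g r) Ur ru (gV Ur) (g_le Ur).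
  rewrite (_ : N x r - N y r = A r * (x r - y r) + B r * (x (g r) - y (g r))).
    apply: le_trans (ler_normD _ _) _; rewrite !normrM.
    have := ABk r Ur ru; have := normr_ge0 (A r); have := normr_ge0 (B r).
    move=> B0 A0 AB; set E := expR _ in wr H1 H2 *.
    have : `|A r| * `|x r - y r| <= `|A r| * (C * E) by rewrite ler_wpM2l.
    have : `|B r| * `|x (g r) - y (g r)| <= `|B r| * (C * E) by rewrite ler_wpM2l.
    have CE : 0 <= C * E by rewrite mulr_ge0// ltW// W0.
    have : C / 2 * (2 * k * E) <= C / 2 * w r by rewrite ler_wpM2l// divr_ge0.
    nra.
  by rewrite /N; ring.
rewrite Jx0 Jy0 subrr subr0 => /le_trans; apply.
have : expR (2 * k * (s - t0)) <= expR (2 * k * (v - t0)).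
  by rewrite ler_expR ler_wpM2l ?mulr_ge0//; lra.
have := W0 t0; nra.
Qed.

Let xn (n : nat) : R -> R := iter n step psi.

Let xn_cont n : cont (xn n).
Proof. by elim: n => [|n IH] //=; exact: step_cont. Qed.

Let xlim (t : R) : R := get [set l : R | forall C : R,
  (forall n, `|xn n.+1 t - xn n t| <= C * 2^-1 ^+ n) ->
  forall n, `|l - xn n t| <= 2 * C * 2^-1 ^+ n].

Let xlim_spec t C : (forall n, `|xn n.+1 t - xn n t| <= C * 2^-1 ^+ n) ->
  forall n, `|xlim t - xn n t| <= 2 * C * 2^-1 ^+ n.
Proof. exact: (getPex (geometric_limit (fun n => xn n t))) C. Qed.

Let xn_close u : U u -> exists k C, [/\ 0 <= k, 0 <= C,
  forall t, U t -> t <= u -> `|A t| + `|B t| <= k &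
  forall n, close k u xlim (xn n) (2 * C * 2^-1 ^+ n)].
Proof.
move=> Uu; have [bA bB] := (rA.1, rB.1).
have [kA HA] := bA t0 u; have [kB HB] := bB t0 u.
have b1 : loc_bounded V (fun s => xn 1 s + -1 * xn 0 s).
  apply: ts_continuous_loc_bounded nV.1 _ => t Vt; apply: ts_continuousD.
    exact: xn_cont.
  by apply: ts_continuousM; [exact: cvg_cst|exact: cpsi].
have [C HC] := b1 t0 u.
have t0u : t0 <= u by case: Uu.
pose k := kA + kB.
have ABk t : U t -> t <= u -> `|A t| + `|B t| <= k.
  by move=> Ut tu; apply: lerD; [apply: HA|apply: HB] => //; rewrite tu andbT; case: Ut.
have k0 : 0 <= k by apply: le_trans (ABk u Uu (lexx u)); rewrite addr_ge0.
have C0 : 0 <= C by apply: le_trans (HC t0 Vt0 _); rewrite ?lexx.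
have W1 v : U v -> 1 <= expR (2 * k * (v - t0)).
  by move=> [_ /= t0v]; rewrite -expR0 ler_expR !mulr_ge0// subr_ge0.
have cl n : close k u (xn n.+1) (xn n) (C * 2^-1 ^+ n).
  elim: n => [|n IH].
    move=> v s Uv vu Vs sv; rewrite expr0 mulr1.
    have [st0|t0s] := leP s t0.
      by rewrite /= step_le// subrr normr0 mulr_ge0// (le_trans _ (W1 v Uv)).
    have := HC s Vs; rewrite (ltW t0s) (le_trans sv vu) mulN1r => /(_ isT) H.
    by apply: le_trans H _; rewrite ler_peMr// W1.
  rewrite exprSr mulrA; apply: step_close Uu k0 _ (@xn_cont _) (@xn_cont _) ABk IH.
  by rewrite mulr_ge0// exprn_ge0// invr_ge0.
exists k, C; split; [exact: k0|exact: C0|exact: ABk|]; move=> n v s Uv vu Vs sv.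
have := @xlim_spec s (C * expR (2 * k * (v - t0))).
have H m : `|xn m.+1 s - xn m s| <= C * expR (2 * k * (v - t0)) * 2^-1 ^+ m.
  by rewrite mulrAC; exact: cl.
by move=> /(_ H n); rewrite mulrA [leRHS]mulrAC.
Qed.

Let xlim_cont : cont xlim.
Proof.
move=> t Vt; apply/ts_continuousP => e e0.
have [u Vu tu] := unbounded_gt (Num.max t t0 + 1) nV.
have [tu1 t0u] : t + 1 <= u /\ t0 <= u.
  have : t <= Num.max t t0 by rewrite le_max lexx.
  have : t0 <= Num.max t t0 by rewrite le_max lexx orbT.
  by split; lra.
have Uu : U u by split.
have [k [C [k0 C0 _ cl]]] := xn_close Uu.
have [n Hn] := @geometric_small _ (2 * C * expR (2 * k * (u - t0))) (e / 3)
  (ltac:(lra)).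
have /ts_continuousP/(_ (e / 3) (ltac:(lra)))[r r0 Hr] := @xn_cont n t Vt.
exists (Num.min r 1); first by rewrite lt_min r0 ltr01.
move=> s Vs; rewrite lt_min => /andP[ts1 ts2].
have su : s <= u by move: ts2; rewrite ltr_distl => /andP[]; lra.
have H1 := cl n u s Uu (lexx u) Vs su.
have H2 := cl n u t Uu (lexx u) Vt (ltac:(lra)).
have H3 := Hr s Vs ts1.
rewrite mulrAC in Hn.
rewrite (_ : xlim t - xlim s = (xlim t - xn n t) + (xn n t - xn n s)
  - (xlim s - xn n s)); last by ring.
apply: le_lt_trans (ler_normB _ _) _.
by apply: le_lt_trans (lerD (ler_normD _ _) (lexx _)) _; lra.
Qed.

Let xlim_fixed s : V s -> step xlim s = xlim s.
Proof.
move=> Vs; have Uu := max_in Vs; set u := Num.max s t0 in Uu.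
have su : s <= u by rewrite le_max lexx.
have [k [C [k0 C0 ABk cl]]] := xn_close Uu.
apply/eqP; rewrite -subr_eq0 -normr_le0; apply/ler_addgt0Pl => e e0; rewrite addr0.
have [n Hn] := @geometric_small _ (2 * C * expR (2 * k * (u - t0))) e e0.
have C2 : 0 <= 2 * C * 2^-1 ^+ n by rewrite !mulr_ge0// exprn_ge0// invr_ge0.
have := step_close Uu k0 C2 xlim_cont (@xn_cont n) ABk (cl n).
move=> /(_ u s Uu (lexx u) Vs su).
have := cl n.+1 u s Uu (lexx u) Vs su; rewrite exprSr mulrA mulrAC in Hn *.
rewrite distrC => H1 H2.
rewrite (_ : _ - _ = (step xlim s - step (xn n) s) + (xn n.+1 s - xlim s)); last first.
  by rewrite /=; ring.
by apply: le_trans (ler_normD _ _) _; lra.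
Qed.

(** Continuity is asserted on all of [V], history included, because antiderivatives of expressions
    in [x] are taken there. The witness is [step xlim], which agrees with [xlim] on [V] and shows
    both the initial values and the derivative. *)
Lemma delay_solution_exists : exists x : R -> R,
  [/\ forall t, V t -> t <= t0 -> x t = psi t,
      forall t, V t -> ts_continuous V x t &
      forall t, U t -> is_delta_derive U x t (A t * x t + B t * x (g t))].
Proof.
have [_ dJ] := J_spec (N_regular xlim_cont).
exists (step xlim); split.
- by move=> t _ tt0; rewrite step_le//; exact: xlim_cont.
- exact: step_cont xlim_cont.
move=> t Ut; rewrite !xlim_fixed; [|exact: gV|exact: UV].
apply: (@delta_derive_ext _ _ (fun s => psi t0 + J (N xlim) s)) => //.
  by move=> s [_ /= t0s]; rewrite step_ge.
rewrite -[_ + _]add0r; apply: delta_deriveD; first exact: delta_derive_cst.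
exact: dJ.
Qed.

End Picard.

(** * Increasing bijections between time scales *)

Section IncreasingBijection.

Variables (R : realType) (S V : set R) (g p : R -> R).
Hypotheses (nS : unbounded_scale S) (nV : unbounded_scale V).
Hypotheses (gV : forall t, S t -> V (g t))
  (g_onto : forall s, V s -> exists2 t, S t & g t = s)
  (g_incr : forall t u, S t -> S u -> t < u -> g t < g u)
  (pK : forall t, S t -> p (g t) = t).

Lemma bijection_lt_reflect t u : S t -> S u -> g t < g u -> t < u.
Proof.
move=> St Su; have [//|ut|->] := ltgtP t u; last by rewrite ltxx.
by move=> /lt_trans/(_ (g_incr Su St ut)); rewrite ltxx.
Qed.

(** An order isomorphism carries an immediate successor to an immediate successor. At a right-dense
    [t], continuity of [g] supplies points of [V] just above [g t]. *)
Lemma bijection_sigma t :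
  S t -> ts_continuous S g t -> sigma V (g t) = g (sigma S t).
Proof.
move=> St /ts_continuousP gc; apply/eqP; rewrite eq_le; apply/andP; split; last first.
  apply: lb_le_inf.
    by have [s Vs gs] := unbounded_gt (g t) nV; exists s.
  move=> s [Vs]; have [r Sr <-] := g_onto Vs => /(bijection_lt_reflect St Sr) tr.
  have /predU1P[<- //|sr] : (sigma S t == r) || (sigma S t < r).
    by rewrite -le_eqVlt sigma_le.
  by apply/ltW/g_incr => //; exact: sigma_in nS.
have /predU1P[st|st] : (t == sigma S t) || (t < sigma S t).
- by rewrite -le_eqVlt sigma_ge.
- rewrite -st; apply/ler_addgt0Pl => e e0; have [r r0 gr] := gc e e0.
  have [s Ss /andP[ts sr]] := sigma_dense_gt nS (esym st) r0.
  have gts := g_incr St Ss ts.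
  have : `|t - s| < r by rewrite distrC gtr0_norm ?subr_gt0//; lra.
  move=> /(gr s Ss); rewrite distrC gtr0_norm ?subr_gt0// ltrBlDr => /ltW.
  exact/le_trans/(sigma_le (gV Ss) gts).
- by apply: sigma_le; [exact: gV (sigma_in t nS)|exact: g_incr (sigma_in t nS) st].
Qed.

(** As [S] is closed, it has a first point at or after [t + e] and, if any, a last point at or
    before [t - e]. Their images under [g] delimit a neighbourhood of [g t] that [p] sends into
    [(t - e, t + e)]. *)
Lemma bijection_inv_continuous s : V s -> ts_continuous V p s.
Proof.
move=> Vs; have [t St <-] := g_onto Vs; rewrite /ts_continuous.
apply/ts_continuousP => e e0.
have [q1 q10 H1] : exists2 q : R, 0 < q & forall u, S u -> g u < g t + q -> u < t + e.
  pose A := S `&` [set u | t + e <= u].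
  have lbA : has_lbound A by exists (t + e) => u [].
  have A0 : A !=set0.
    by have [u Su /ltW tu] := unbounded_gt (t + e) nS; exists u.
  have Sq : S (inf A) by apply: (closed_inf nS.1 _ A0 lbA) => u [].
  have tq : t + e <= inf A by apply: lb_le_inf => // u [].
  exists (g (inf A) - g t); first by rewrite subr_gt0 g_incr//; lra.
  move=> u Su; rewrite addrC subrK => /(bijection_lt_reflect Su Sq) uq.
  rewrite ltNge; apply/negP => tu.
  by have := ge_inf lbA (conj Su tu); rewrite leNgt uq.
have [q2 q20 H2] : exists2 q : R, 0 < q & forall u, S u -> g t - q < g u -> t - e < u.
  pose A := S `&` [set u | u <= t - e].
  have ubA : has_ubound A by exists (t - e) => u [].
  have [A0|A0] := pselect (A !=set0); last first.
    exists 1 => // u Su _; rewrite ltNge; apply/negP => ut.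
    by apply: A0; exists u.
  have Sq : S (sup A) by apply: (closed_sup nS.1 _ A0 ubA) => u [].
  have tq : sup A <= t - e by apply: ge_sup => // u [].
  exists (g t - g (sup A)); first by rewrite subr_gt0 g_incr//; lra.
  move=> u Su; rewrite subKr => /(bijection_lt_reflect Sq Su) uq.
  rewrite ltNge; apply/negP => tu.
  by have := ub_le_sup ubA (conj Su tu); rewrite leNgt uq.
exists (Num.min q1 q2); first by rewrite lt_min q10.
move=> r Vr; have [u Su <-] := g_onto Vr.
rewrite !pK// lt_min !ltr_distl => /andP[/andP[a1 a2] /andP[b1 b2]].
by have := H1 u Su; have := H2 u Su => c1 c2;
  apply/andP; split; [have := c2 (ltac:(lra))|have := c1 (ltac:(lra))]; lra.
Qed.

End IncreasingBijection.

(** * The Lyapunov functional along a solution *)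

(* [F], [G] and [P] are antiderivatives of [B x], [(B x) ^ 2] and [B ^ 2], so  *)
(* the integrals over [g t, t] in the functional are increments of [F] and [G]. *)
Section Lyapunov.

Variables (R : realType) (V : set R) (t0 : R) (a b B g gd x F G P : R -> R).
Variables (D beta0 : R).
Hypotheses (nV : unbounded_scale V) (Vt0 : V t0).

Let S : set R := ts_ge V t0.

Hypotheses (gV : forall t, S t -> V (g t)) (g_le : forall t, S t -> g t <= t).
Hypotheses (g_sigma : forall t, S t -> sigma V (g t) = g (sigma S t))
  (dg : forall t, S t -> is_delta_derive S g t (gd t))
  (gd_ge0 : forall t, S t -> 0 <= gd t).
Hypotheses (beta0_gt0 : 0 < beta0) (beta0_lt_D : beta0 < D)
  (beta_le : forall t, S t -> t - g t <= beta0).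
Hypotheses (Bg : forall t, S t -> B (g t) = b t)
  (B_neq0 : forall t, S t -> B t != 0)
  (DB_le : forall t, S t -> D * B t ^+ 2 <= a t + B t).
Hypotheses
  (dx : forall t, S t -> is_delta_derive S x t (a t * x t + b t * gd t * x (g t)))
  (dF : forall t, V t -> is_delta_derive V F t (B t * x t))
  (dG : forall t, V t -> is_delta_derive V G t ((B t * x t) ^+ 2))
  (dP : forall t, V t -> is_delta_derive V P t (B t ^+ 2)).

Let z (t : R) : R := x t + (F t - F (g t)).
Let L (t : R) : R := z t ^+ 2 - D * (G t - G (g t)).

Let SV : S `<=` V. Proof. by move=> t []. Qed.

Let nS : unbounded_scale S. Proof. exact: unbounded_ts_ge. Qed.

Let D_gt0 : 0 < D. Proof. exact: lt_trans beta0_lt_D. Qed.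

Lemma delay_energy t : S t ->
  0 <= G t - G (g t) /\ (F t - F (g t)) ^+ 2 <= beta0 * (G t - G (g t)).
Proof.
move=> St; have [Vt Vg gt] := And3 (SV St) (gV St) (g_le St).
have G0 : 0 <= G t - G (g t).
  have := @delta_increment_le _ V (fun=> 0) G (fun=> 0) _ (g t) t nV Vg Vt gt
    (fun r _ _ => delta_derive_cst V 0 r) (fun r Vr _ => dG Vr)
    (fun r _ _ _ => sqr_ge0 _).
  by rewrite subrr.
split=> //; apply: le_trans (_ : (t - g t) * (G t - G (g t)) <= _).
  apply: (delta_cauchy_schwarz nV Vg Vt gt (fun r Vr _ => dF Vr)).
  by move=> r Vr _; exact: dG.
by rewrite ler_wpM2r ?beta_le.
Qed.

Lemma lyapunov_le t : S t -> (D - beta0) * L t <= D * x t ^+ 2.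
Proof.
move=> St; have [I0 wI] := delay_energy St; rewrite /L /z.
set w := F t - _ in wI *; set I := G t - _ in I0 wI *; set y := x t.
have Db : 0 < D - beta0 by rewrite subr_gt0.
(* After multiplication by [beta0], the two sides differ by exactly this square plus
   [(D - beta0) * D * (beta0 * I - w ^ 2)]. *)
have := sqr_ge0 (beta0 * y - (D - beta0) * w).
have : (D - beta0) * D * w ^+ 2 <= (D - beta0) * D * (beta0 * I).
  by rewrite ler_wpM2l// mulr_ge0// ltW.
move=> H1 H2; rewrite -(ler_pM2l beta0_gt0); nra.
Qed.

Let zd (t : R) : R := (a t + B t) * x t.

(** Because [B (g t) = b t], the derivative of [F (g t)] is precisely the delayed term of the
    equation, and the two cancel. *)
Let dzt t : S t -> is_delta_derive S z t (zd t).
Proof.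
move=> St; rewrite (_ : zd t = (a t * x t + b t * gd t * x (g t)) +
  (B t * x t - B (g t) * x (g t) * gd t)); last by rewrite /zd Bg//; ring.
have [_ t0t] := St; apply: delta_deriveD (dx St) _; apply: delta_deriveB.
  by apply: delta_derive_sub (dF (SV St)) => //; exact: sigma_ts_ge.
by apply: delta_derive_comp gV St (g_sigma St) (dg St) (dF (gV St)).
Qed.

Let Ld (t : R) : R := zd t * (z t + z (sigma S t)) -
  D * ((B t * x t) ^+ 2 - (B (g t) * x (g t)) ^+ 2 * gd t).

Let dL t : S t -> is_delta_derive S L t (Ld t).
Proof.
move=> St; have [_ t0t] := St; apply: delta_deriveB.
  by apply: delta_derive_sqr => //; exact: dzt.
apply: delta_deriveZ; apply: delta_deriveB.
  by apply: delta_derive_sub (dG (SV St)) => //; exact: sigma_ts_ge.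
by apply: delta_derive_comp gV St (g_sigma St) (dg St) (dG (gV St)).
Qed.

(** With [Z = y + w] one has [2 * y * Z - Z ^ 2 = y ^ 2 - w ^ 2], and the difference of the two
    sides splits into four nonnegative terms, due to Cauchy-Schwarz, to [D * B ^ 2 <= Q], to the
    graininess, and to the delayed energy with [gd >= 0]. *)
Let Ld_ge t : S t -> (a t + B t) * L t <= Ld t.
Proof.
move=> St; have [I0 wI] := delay_energy St; have DB := DB_le St.
rewrite /Ld (delta_derive_sigma St (dzt St)) /L.
have m0 : 0 <= sigma S t - t by rewrite subr_ge0 sigma_ge.
have := mulr_ge0 (sqr_ge0 (B (g t) * x (g t))) (gd_ge0 St).
set E := _ * gd t; set mu := sigma S t - t in m0 *; move=> E0.
rewrite /zd; set Q := a t + B t in DB *.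
set w := F t - F (g t) in wI *; set I := G t - _ in I0 wI *.
have zx : z t = x t + w by [].
set y := x t in zx *; set Z := z t in zx *.
have B20 := sqr_ge0 (B t).
have Q0 : 0 <= Q by apply: le_trans DB; rewrite mulr_ge0// ltW.
have h1 : 0 <= Q * (D * I - w ^+ 2).
  by rewrite mulr_ge0// subr_ge0; apply: le_trans wI _; rewrite ler_wpM2r// ltW.
have h2 : 0 <= (Q - D * B t ^+ 2) * y ^+ 2 by rewrite mulr_ge0 ?sqr_ge0// subr_ge0.
have h3 : 0 <= (Q * y) ^+ 2 * mu by rewrite mulr_ge0 ?sqr_ge0.
have h4 : 0 <= D * E by rewrite mulr_ge0// ltW.
rewrite -subr_ge0.
rewrite (_ : _ - _ = Q * (D * I - w ^+ 2) + (Q - D * B t ^+ 2) * y ^+ 2 +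
  (Q * y) ^+ 2 * mu + D * E); first by rewrite !addr_ge0.
by rewrite (_ : Z = y + w)//; ring.
Qed.

(** The barrier at level [L t0] applies because [Ld] is strictly positive wherever [L >= L t0].
    Replacing [L] by [L t0] in the lower bound of [Ld] then leaves an integrand with the known
    antiderivative [L t0 * D * P]. *)
Lemma lyapunov_ge t : S t -> 0 < L t0 -> L t0 * (1 + D * (P t - P t0)) <= L t.
Proof.
move=> St L0; have St0 : S t0 by split=> /=.
have t0t s : S s -> t0 <= s by case.
have DB0 s : S s -> 0 < D * B s ^+ 2.
  by move=> Ss; rewrite mulr_gt0// exprn_even_gt0//= B_neq0.
have Lpos s : S s -> L t0 <= L s.
  move=> Ss; apply: (@delta_barrier _ S L Ld t0 s _ nS St0 t0t Ss dL) => //.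
  move=> r Sr _ Lr; apply: lt_le_trans (Ld_ge Sr).
  by rewrite mulr_gt0 ?(lt_le_trans L0 Lr)// (lt_le_trans (DB0 r Sr) (DB_le Sr)).
suff : L t0 * D * P t - L t0 * D * P t0 <= L t - L t0 by lra.
apply: (@delta_increment_le _ S (fun s => L t0 * D * P s) L
  (fun s => L t0 * D * B s ^+ 2) Ld) => //.
- exact: t0t.
- move=> s Ss t0s; apply: delta_deriveZ.
  by apply: delta_derive_sub (dP (SV Ss)) => //; exact: sigma_ts_ge.
- by move=> s Ss _; exact: dL.
- move=> s Ss _ _; apply: le_trans (Ld_ge Ss).
  rewrite -mulrA mulrC; apply: ler_pM => //; try exact/ltW.
  + by apply/ltW/DB0.
  + exact: DB_le.
  + exact: Lpos.
Qed.

End Lyapunov.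

(** * The delay, the integral and the initial energy *)

(** P.3 and P.4 give [dm t0 t = t], and P.2 makes [dm] decrease when its first argument grows from
    [t0] to [h]. *)
Lemma shift_lt (R : realType) (T Ts : set R) (t0 h : R) (dm dp : shift_op R) (t : R) :
  shift_operators T Ts t0 dm dp -> delay_function T Ts t0 dm dp h ->
  ts_ge T t0 t -> dm h t < t.
Proof.
move=> sh de St; have [_ t0h] := delay_h de; have Dh := delay_Dm de St.
have [_ Tst _ _] := Dh; have [D0 E0] := shift_P3r sh Tst.
have [D1 E1] := shift_P4p sh D0.
by rewrite E0 in D1 E1; have := shift_P2m sh D1 Dh t0h; rewrite E1.
Qed.

Lemma delta_derive_incr_ge0 (R : realType) (U : set R) (g : R -> R) (t d : R) :
  unbounded_scale U -> U t -> (forall t u, U t -> U u -> t < u -> g t < g u) ->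
  is_delta_derive U g t d -> 0 <= d.
Proof.
move=> nU Ut gi dg; apply/ler_addgt0Pl => e e0.
have /predU1P[st|st] : (t == sigma U t) || (t < sigma U t).
- by rewrite -le_eqVlt sigma_ge.
- have /near_dist[r r0 H] := dg e e0.
  have [s Us /andP[ts sr]] := sigma_dense_gt nU (esym st) r0.
  have tsr : `|t - s| < r by rewrite distrC gtr0_norm ?subr_gt0//; lra.
  have := H s tsr Us; have := gi t s Ut Us ts; rewrite -st => gts.
  rewrite [`|t - s|]distrC (gtr0_norm (_ : 0 < s - t)) ?subr_gt0// ler_norml.
  move=> /andP[H1 _]; have st0 : 0 < s - t by rewrite subr_gt0.
  by rewrite -(pmulr_lge0 _ st0); nra.
- have := gi t _ Ut (sigma_in t nU) st; rewrite (delta_derive_sigma Ut dg).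
  by rewrite ltrDl pmulr_lgt0 ?subr_gt0// => d0; rewrite addr_ge0// ltW.
Qed.

(** Two antiderivatives of [f] bound each other's increments, so the value does not depend on the
    choice made by [get]. *)
Lemma delta_integralE (R : realType) (U : set R) (F f : R -> R) (c d : R) :
  unbounded_scale U -> U c -> U d -> c <= d ->
  is_delta_antiderivative U F f -> delta_integral U f c d = F d - F c.
Proof.
move=> nU Uc Ud cd dF.
have [G dG ->] : [set I | exists2 G, is_delta_antiderivative U G f & I = G d - G c]
    (delta_integral U f c d).
  by apply: getPex; exists (F d - F c), F.
by apply/eqP; rewrite eq_le; apply/andP; split;
  apply: (@delta_increment_le _ U _ _ f f) => // t Ut _;
    [exact: dG|exact: dF|exact: dF|exact: dG].
Qed.

(** Quantitative concentration at [d]: the energy is of order [1 / l] while [x d = k] is fixed. The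
    square of the exponential has rate [2 * l], so the exponential divided by [2 * l] dominates its
    integral. *)
Lemma integral_small (R : realType) (V : set R) (F G B x : R -> R)
    (c d l k K : R) :
  unbounded_scale V -> V c -> V d -> c <= d -> 0 < l ->
  (forall t, V t -> c <= t -> t <= d -> `|B t| <= K) ->
  (forall t, V t -> t <= d -> x t = k * expR (l * (t - d))) ->
  (forall t, V t -> is_delta_derive V G t ((B t * x t) ^+ 2)) ->
  2 * l * (G d - G c) <= K ^+ 2 * k ^+ 2.
Proof.
move=> nV Vc Vd cd l0 BK xE dG.
have [w Hw] := @delta_derive_expR _ V (2 * l) d nV (ltac:(lra)).
suff : 2 * l * G d - 2 * l * G c <= K ^+ 2 * k ^+ 2 * expR (2 * l * (d - d))
    - K ^+ 2 * k ^+ 2 * expR (2 * l * (c - d)).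
  rewrite subrr mulr0 expR0 mulr1 -mulrBr => /le_trans; apply.
  by rewrite gerBl; apply: mulr_ge0 (expR_ge0 _); apply: mulr_ge0; exact: sqr_ge0.
apply: (@delta_increment_le _ V (fun t => 2 * l * G t)
  (fun t => K ^+ 2 * k ^+ 2 * expR (2 * l * (t - d)))
  (fun t => 2 * l * (B t * x t) ^+ 2) (fun t => K ^+ 2 * k ^+ 2 * w t)) => //.
- by move=> t Vt _; apply: delta_deriveZ; exact: dG.
- by move=> t Vt _; apply: delta_deriveZ; have [] := Hw t Vt.
move=> t Vt ct td; have [_ wt] := Hw t Vt; rewrite xE ?(ltW td)//.
have EE : expR (2 * l * (t - d)) = expR (l * (t - d)) ^+ 2.
  by rewrite expr2 -expRD; congr expR; ring.
rewrite (_ : 2 * l * _ =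
  B t ^+ 2 * (k ^+ 2 * (2 * l * expR (2 * l * (t - d))))); last first.
  by rewrite EE; ring.
rewrite -[leRHS]mulrA; apply: ler_pM.
- exact: sqr_ge0.
- by apply: mulr_ge0 (sqr_ge0 _) (mulr_ge0 _ (expR_ge0 _)); lra.
- have := BK t Vt ct (ltW td); rewrite -(real_normK (num_real (B t))) => BtK.
  by rewrite lerXn2r// nnegrE// (le_trans _ BtK).
- by rewrite ler_wpM2l ?sqr_ge0.
Qed.

(** * Instability of the zero solution *)

Theorem theorem8 (R : realType) (T Ts : set R) (t0 h : R)
    (dm dp : shift_op R) (a b : R -> R) (M D beta0 : R)
    (T_ts : time_scale T) (T_unbounded : ~ has_ubound T)
    (t0_ge0 : 0 <= t0)
    (shifts : shift_operators T Ts t0 dm dp)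
    (delay : delay_function T Ts t0 dm dp h)
    (a_rd : rd_continuous T T a) (b_rd : rd_continuous T T b)
    (delta_bound : forall t, ts_ge T t0 t ->
       `|delta_derive (ts_ge T t0) (dm h) t| <= M)
    (D_gt0 : 0 < D)
    (b_neq0 : forall t, ts_ge T t0 t -> b (dp h t) != 0)
    (beta_lt_D : forall t, ts_ge T t0 t -> t - dm h t < D)
    (D_le_Q : forall t, ts_ge T t0 t ->
       D <= (a t + b (dp h t)) / b (dp h t) ^+ 2)
    (beta0_gt0 : 0 < beta0) (beta0_lt_D : beta0 < D)
    (beta_le : forall t, ts_ge T t0 t -> t - dm h t <= beta0)
    (int_infty :
       delta_integral (ts_ge T t0) (fun s => b (dp h s) ^+ 2) t0 t
         @[t --> within (ts_ge T t0) +oo] --> +oo) :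
  zero_unstable T t0 dm h a b.
Proof.
move=> stable; have [r r0 {}stable] := stable 1 ltr01.
have nT : unbounded_scale T := conj T_ts.2 T_unbounded.
have Tt0 : T t0 := shift_Ts_sub shifts (shift_Ts_t0 shifts).
pose S := ts_ge T t0; pose g := dm h; pose p := dp h.
have nS : unbounded_scale S by exact: unbounded_ts_ge.
have St0 : S t0 by split=> /=.
have g_lt t : S t -> g t < t by exact: shift_lt shifts delay.
pose V := ts_ge T (g t0).
have nV : unbounded_scale V by exact: unbounded_ts_ge.
have Vt0 : V t0 by split=> //; exact/ltW/g_lt.
have SE : ts_ge V t0 = S.
  apply/seteqP; split=> t [] => [[Tt _] tt0|Tt /= tt0]; first by split.
  by split=> //; split=> //=; apply: le_trans tt0; exact/ltW/g_lt.
have SV : S `<=` V by rewrite -SE => t [].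
have onto : g @` S = V := delay_onto delay.
have gV t : S t -> V (g t) by move=> St; rewrite -onto; exists t.
have g_onto s : V s -> exists2 t, S t & g t = s by rewrite -onto.
have g_incr := delay_incr delay.
have pK t : S t -> p (g t) = t := @delay_invl _ _ _ _ _ _ _ delay t.
pose gd := delta_derive S g.
have dg t : S t -> is_delta_derive S g t (gd t).
  move=> St; suff : [set d | is_delta_derive S g t d] (gd t) by [].
  exact: getPex (delay_derivable delay St).
have g_cts t : S t -> ts_continuous S g t.
  by move=> St; exact: delta_derive_continuous St (dg t St).
have g_sigma t : S t -> sigma V (g t) = g (sigma S t).
  by move=> St; exact: bijection_sigma (g_cts t St).
have p_cts s : V s -> ts_continuous V p s.
  exact: (bijection_inv_continuous nS g_onto g_incr pK).
have pS s : V s -> S (p s).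
  by move=> /g_onto[t St <-]; rewrite pK.
have p_le s u : V s -> V u -> s <= u -> p s <= p u.
  move=> /g_onto[t St <-] /g_onto[q Sq <-]; rewrite !pK// => gtq.
  by rewrite leNgt; apply/negP => qt; have := g_incr q t Sq St qt; rewrite ltNge gtq.
have sST t : S t -> sigma S t = sigma T t by case=> _ t0t; exact: sigma_ts_ge.
have sVT t : V t -> sigma V t = sigma T t by case=> _ t0t; exact: sigma_ts_ge.
have rdT f t : rd_continuous T T f -> T t -> sigma T t = t -> ts_continuous T f t.
  by move=> rf Tt st; have [+ _] := rf t Tt; apply; split=> //; exact: unbounded_gt.
have ST : S `<=` T by move=> t [].
have regT f : rd_continuous T T f -> ts_regular S f.
  move=> rf; split=> [c d|t St st].
    have [K HK] := rd_continuous_loc_bounded nT rf c d.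
    by exists K => t /ST; exact: HK.
  by apply: (ts_continuous_sub ST); apply: rdT => //; [exact: ST|rewrite -sST].
have reg_gd : ts_regular S gd.
  split=> [c d|t St st]; first by exists M => t St _; exact: delta_bound.
  have [+ _] := delay_rd delay St; apply; split; last by rewrite -sST.
  exact: unbounded_gt.
pose B s := b (p s).
have regB : ts_regular V B.
  split=> [c d|s Vs ss].
    have [u Vu du] := unbounded_gt d nV.
    have [K HK] := rd_continuous_loc_bounded nT b_rd t0 (p u).
    exists K => s Vs /andP[_ sd]; have [Tp t0p] := pS s Vs.
    by apply: HK => //; rewrite t0p p_le//; lra.
  apply: (@ts_continuous_comp _ V T b p); [by move=> q /pS[]|exact: p_cts|].
  have Sp := pS s Vs; apply: rdT => //; first exact: ST.
  (* Right-density passes from [s] to [p s]: a gap of [S] after [p s] would be carried by [g] to a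
     gap of [V] after [s]. *)
  have [t St gts] := g_onto s Vs; rewrite -gts pK// -sST//.
  apply/eqP; rewrite eq_le sigma_ge// andbT leNgt; apply/negP => st.
  have : g t < g (sigma S t) := g_incr t _ St (sigma_in t nS) st.
  by rewrite -g_sigma// gts ss ltxx.
have [K HK] := regB.1 (g t0) t0.
(* With [c = r / 2] and [I] the integral of [(B x) ^ 2] over [[g t0, t0]], [integral_small] gives
   [2 * l * I <= K ^ 2 * c ^ 2]. This [l] turns it into [2 * (beta0 + D) * I < c ^ 2]; the [+ 1]
   makes the inequality strict. *)
pose l := (beta0 + D) * K ^+ 2 + 1.
have l0 : 0 < l by rewrite ltr_wpDl// mulr_ge0 ?sqr_ge0// addr_ge0// ltW.
pose psi t := r / 2 * expR (l * (t - t0)).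
have psi_cts : continuous psi.
  move=> t; apply: cvgM; first exact: cvg_cst.
  apply: continuous_comp; last exact: continuous_expR.
  by apply: cvgM; [exact: cvg_cst|apply: cvgB => //; exact: cvg_cst].
have [x [xpsi x_cts dx]] :
  exists x : R -> R, [/\ forall t, V t -> t <= t0 -> x t = psi t,
      forall t, V t -> ts_continuous V x t &
      forall t, S t -> is_delta_derive S x t (a t * x t + b t * gd t * x (g t))].
  have := @delay_solution_exists R V t0 g a (fun t => b t * gd t) psi nV Vt0.
  rewrite SE; apply => //.
  - by move=> t St; exact/ltW/g_lt.
  - exact: regT.
  - by apply: ts_regularM => //; exact: regT.
  - by move=> t _; apply: cvg_within_filter; exact: psi_cts.
have sol : is_solution T t0 dm h a b psi x.
  split=> [t [Tt /andP[t1 t2]]|t St]; first by apply: xpsi.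
  rewrite (_ : b t * _ * _ = b t * gd t * x (g t)); first exact: dx.
  by rewrite mulrAC.
have x_lt1 : forall t, S t -> `|x t| < 1.
  apply: stable sol _ => [t At|].
    split=> _; first by apply: cvg_within_filter; exact: psi_cts.
    by exists (psi t); apply: cvg_within_filter; exact: psi_cts.
  apply: (@le_lt_trans _ _ (r / 2)); last by lra.
  apply: ge_sup.
    by exists `|psi t0|, t0 => //; split=> //=; rewrite lexx andbT; exact/ltW/g_lt.
  move=> _ [t [_ /andP[_ tt0]] <-].
  rewrite ger0_norm /psi; last by rewrite mulr_ge0 ?expR_ge0//; lra.
  rewrite ler_piMr//; first by lra.
  by rewrite -expR0 ler_expR mulr_ge0_le0 ?(ltW l0)// subr_le0.
have reg_x : ts_regular V x by exact: ts_regular_continuous nV.1 x_cts.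
have regBx := ts_regularM regB reg_x.
have V_min t : V t -> g t0 <= t by case.
have Vg0 := gV t0 St0.
have anti f : ts_regular V f -> exists F, forall t, V t -> is_delta_derive V F t (f t).
  move=> [bf cf]; have [F _ dF] := delta_antiderivative_exists nV Vg0 V_min bf cf.
  by exists F.
have [F dF] := anti _ regBx.
have [G dG] := anti (fun t => (B t * x t) ^+ 2) (ts_regularM regBx regBx).
have [P dP] := anti (fun t => B t ^+ 2) (ts_regularM regB regB).
have B2_gt0 t : S t -> 0 < B t ^+ 2.
  by move=> St; rewrite exprn_even_gt0//= b_neq0.
pose L t := (x t + (F t - F (g t))) ^+ 2 - D * (G t - G (g t)).
have g_le t : S t -> g t <= t by move=> /g_lt/ltW.
have gd_ge0 t : S t -> 0 <= gd t.
  by move=> St; exact: delta_derive_incr_ge0 nS St g_incr (dg t St).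
have Bg t : S t -> B (g t) = b t by move=> St; rewrite /B pK.
have DB_le t : S t -> D * B t ^+ 2 <= a t + B t.
  by move=> St; rewrite -ler_pdivlMr ?B2_gt0//; exact: D_le_Q.
have L0 : 0 < L t0.
  have := @delay_energy R V t0 B g x F G beta0 nV.
  rewrite SE => /(_ gV g_le beta_le dF dG t0 St0)[I0 wI].
  have := @integral_small R V F G B x (g t0) t0 l (r / 2) K nV Vg0 Vt0 (g_le t0 St0) l0.
  move=> /(_ _ xpsi dG) I1.
  have {}I1 := I1 (fun t Vt c1 c2 => HK t Vt (introT andP (conj c1 c2))).
  have xt0 : x t0 = r / 2 by rewrite xpsi// /psi subrr mulr0 expR0 mulr1.
  rewrite /L xt0; set w := F t0 - _ in wI *; set I := G t0 - _ in I0 wI I1 *.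
  set c := r / 2 in I1 *; have c0 : 0 < c by rewrite /c; lra.
  have H1 : l * (2 * (beta0 + D) * I) <= (l - 1) * c ^+ 2.
    rewrite (_ : l * _ = (beta0 + D) * (2 * l * I)); last by ring.
    rewrite (_ : l - 1 = (beta0 + D) * K ^+ 2); last by rewrite /l addrK.
    by rewrite -[leRHS]mulrA; apply: ler_wpM2l I1; rewrite addr_ge0// ltW.
  have H2 : 2 * (beta0 + D) * I < c ^+ 2.
    rewrite -(ltr_pM2l l0); apply: le_lt_trans H1 _.
    by rewrite ltr_pM2r ?exprn_gt0//; lra.
  (* This square gives [(c + w) ^ 2 >= c ^ 2 / 2 - w ^ 2], while [w ^ 2 + D * I <= (beta0 + D) * I <
     c ^ 2 / 2]. *)
  have := sqr_ge0 (c + 2 * w); nra.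
have bound t : S t -> L t0 * (1 + D * (P t - P t0)) * (D - beta0) <= D.
  move=> St.
  have := @lyapunov_ge R V t0 a b B g gd x F G P D beta0 nV Vt0.
  rewrite SE => /(_ gV g_le g_sigma dg gd_ge0 beta0_gt0 beta0_lt_D beta_le Bg
    b_neq0 DB_le dx dF dG dP t St L0) H1.
  have := @lyapunov_le R V t0 B g x F G D beta0 nV.
  rewrite SE => /(_ gV g_le beta0_gt0 beta0_lt_D beta_le dF dG t St) H2.
  have Db : 0 < D - beta0 by rewrite subr_gt0.
  apply: le_trans (_ : (D - beta0) * L t <= _).
    by rewrite mulrC ler_wpM2l// ltW.
  apply: le_trans H2 _; rewrite ler_piMr ?(ltW D_gt0)//.
  by rewrite -real_normK ?num_real// expr_le1// ltW// x_lt1.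
(* The value of [q] that solves [L t0 * (D * q) * (D - beta0) = D]; an integral of [B ^ 2] beyond it
   violates [bound]. *)
pose A := (L t0)^-1 * (D / (D - beta0)) / D.
have /cvgryPgt/(_ A) := int_infty; rewrite near_withinE => -[k [_ Hk]].
have [t Tt] := unbounded_gt (Num.max k t0) nT.
rewrite gt_max => /andP[kt t0t]; have St : S t by split=> //; exact: ltW.
have := Hk t kt St; rewrite (@delta_integralE _ S P)//; last 2 first.
- exact: ltW.
- move=> s Ss; apply: (delta_derive_sub SV _ (dP s (SV s Ss))).
  by rewrite sST// sVT//; exact: SV.
have := bound t St; set q := P t - P t0 => H1 H2.
have Db : 0 < D - beta0 by rewrite subr_gt0.
have : D < L t0 * (1 + D * q) * (D - beta0).
  rewrite -ltr_pdivrMr// -ltr_pdivrMl//.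
  by move: H2; rewrite /A ltr_pdivrMr//; lra.
by rewrite ltNge H1.
Qed.
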